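(* Let $K$ be a field and let $\theta$ be a unital action of an inverse monoid $S$ on a unital associative $K$-algebra $A$. Assume that $A$ is separable over $K$. Then for any $A\rtimes_\theta S$-bimodule $M$ there is an isomorphism $$H^n(S, M^A) \cong H^{n}(A\rtimes_\theta S, M)$$ (for every $n\ge 0$), where $M^A=\{x\in M \mid a\cdot x=x\cdot a \text{ for all } a\in A\}$.
   Context: Inverse monoids and actions. For an inverse monoid $S$, $E(S)$ is its set of idempotents, $s\le t$ means $s=et$ for some $e\in E(S)$, and $KS$, $KE(S)$ are the semigroup algebras (free $K$-modules on $S$, $E(S)$ with the multiplication extended linearly). $\mathcal I(A)$ is the symmetric inverse monoid of all bijections between subsets of $A$. A unital action of $S$ on $A$ is a semigroup homomorphism $\theta:S\to\mathcal I(A)$, $s\mapsto\theta_s$, such that the domain and range of each $\theta_s$ are ideals of $A$, $\theta_s$ is an isomorphism of $K$-algebras from its domain onto its range, $\theta_{1_S}=\mathrm{id}_A$, and the range of $\theta_s$ is $1_sA$ for some central idempotent $1_s$ of $A$ (so $\theta_s:1_{s^{-1}}A\to 1_sA$). Crossed product. $L(A,\theta,S)=\bigoplus_{s\in S}1_sA\,\delta_s$ ($\delta_s$ are symbols) with product $a\delta_s\cdot b\delta_t=a\,\theta_s(1_{s^{-1}}b)\,\delta_{st}$ is an associative $K$-algebra; $\mathcal N$ is its ideal generated by all $a\delta_s-a\delta_t$ with $s\le t$ and $a\in 1_sA$. The crossed product is $A\rtimes_\theta S=L(A,\theta,S)/\mathcal N$; $\overline w$ denotes the class of $w$. The map $A\to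 A\rtimes_\theta S$, $a\mapsto\overline{a\delta_1}$, is an injective homomorphism of unital algebras, and through it any $A\rtimes_\theta S$-bimodule is an $A$-bimodule. Bimodules and Hochschild cohomology. For a unital $K$-algebra $R$, $R^e=R\otimes_K R^{\mathrm{op}}$; $R$-bimodules are identified with left $R^e$-modules by $(a\otimes b)\cdot x=axb$. For an $R$-bimodule $M$, $H^n(R,M)=\operatorname{Ext}^n_{R^e}(R,M)$. $A$ is separable over $K$ if $A$ is projective as an $A^e$-module. $KS$-module structures. An $A\rtimes_\theta S$-bimodule $M$ is a left $KS$-module by $s\cdot x=\overline{1_s\delta_s}\cdot x\cdot\overline{1_{s^{-1}}\delta_{s^{-1}}}$. The subspace $M^A$ is a left $KS$-submodule of $M$. Cohomology of $S$. $KE(S)$ is a left $KS$-module by $s\cdot e=ses^{-1}$ ($e\in E(S)$, $s\in S$). For a left $KS$-module $V$, $H^n(S,V)=\operatorname{Ext}^n_{KS}(KE(S),V)$. *)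

(* Defs.v *)
From HB Require Import structures.
From mathcomp Require Import all_boot all_order ssralg ring_quotient.
From mathcomp Require Import finmap boolp functions.

Set Implicit Arguments.
Unset Strict Implicit.
Unset Printing Implicit Defensive.

Import GRing.Theory.
Local Open Scope quotient_scope.
Local Open Scope ring_scope.

Record submod (R : pzRingType) (V : lmodType R) := Submod {
  smem :> V -> Prop;
  smem0 : smem 0;
  smemP : forall a u v, smem u -> smem v -> smem (a *: u + v) }.

Section Submod.
Variables (R : pzRingType) (V : lmodType R) (P : submod V).

Definition spred : {pred V} := fun x => `[< P x >].

Lemma spredP x : reflect (P x) (x \in spred).
Proof. exact: asboolP. Qed.

Lemma spred_closed : GRing.submod_closed spred.
Proof.
split; first by apply/spredP/smem0.
by move=> a u v /spredP Pu /spredP Pv; apply/spredP/smemP.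
Qed.

HB.instance Definition _ := GRing.isSubmodClosed.Build R V spred spred_closed.

Definition subT : Type := {x : V | x \in spred}.
HB.instance Definition _ := SubChoice.on subT.
HB.instance Definition _ := [SubChoice_isSubZmodule of subT by <:].
HB.instance Definition _ :=
  GRing.SubZmodule_isSubLmodule.Build R V spred subT
    (GRing.submod_closed_semi spred_closed).

Lemma subTP (x : subT) : P (val x).
Proof. exact/spredP/(valP x). Qed.

Definition subI (x : V) (Px : P x) : subT := Sub x (introT (spredP x) Px).

Definition quoT : Type := Quotient.quot spred.
HB.instance Definition _ := GRing.Zmodule.on quoT.
Definition cls (x : V) : quoT := \pi_(Quotient.quot spred) x.
Definition rep (q : quoT) : V := repr (q : Quotient.quot spred).

Lemma repK : cancel rep cls.
Proof. by move=> q; rewrite /cls reprK. Qed.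

Lemma clsP x y : cls x = cls y <-> P (x - y).
Proof.
split=> [/eqP|/spredP h]; first by rewrite -Quotient.idealrBE => /spredP.
by apply/eqP; rewrite -Quotient.idealrBE.
Qed.

Lemma clsD : {morph cls : x y / x + y}.
Proof. exact: Quotient.pi_add. Qed.

Lemma rep_cls x : P (rep (cls x) - x).
Proof. by apply/clsP; rewrite repK. Qed.

Definition quo_scale (a : R) (q : quoT) : quoT := cls (a *: rep q).

Lemma quo_scaleE a x : quo_scale a (cls x) = cls (a *: x).
Proof.
apply/clsP; rewrite -scalerBr -[_ *: _]addr0.
by apply: smemP; [exact: rep_cls|exact: smem0].
Qed.

Lemma quo_scaleA a b q : quo_scale a (quo_scale b q) = quo_scale (a * b) q.
Proof. by rewrite -[q]repK !quo_scaleE scalerA. Qed.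
Lemma quo_scale1 : left_id 1 quo_scale.
Proof. by move=> q; rewrite -[q]repK quo_scaleE scale1r. Qed.
Lemma quo_scaleDr : right_distributive quo_scale +%R.
Proof.
by move=> a p q; rewrite -[p]repK -[q]repK -clsD !quo_scaleE -clsD scalerDr.
Qed.
Lemma quo_scaleDl q : {morph quo_scale^~ q : a b / a + b}.
Proof. by move=> a b; rewrite -[q]repK !quo_scaleE -clsD scalerDl. Qed.
HB.instance Definition _ := GRing.Zmodule_isLmodule.Build R quoT
  quo_scaleA quo_scale1 quo_scaleDr quo_scaleDl.

Lemma cls_linear : linear cls.
Proof. by move=> a x y; rewrite clsD -quo_scaleE. Qed.
HB.instance Definition _ := GRing.isLinear.Build R V quoT *:%R cls cls_linear.

End Submod.

Arguments cls {R V} P x.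

Section Dsum.
Variables (X : choiceType) (V : zmodType).

(* The direct sum of copies of V indexed by X, as finitely supported functions;
   [delta x v] is v in the summand x. *)
Definition dsum : Type := {fsfun X -> V with 0}.
HB.instance Definition _ := Choice.on dsum.

Implicit Types f g : dsum.
Definition dval f : X -> V := fun x => fun_of_fsfun f x.
Definition dsupp f : {fset X} := finsupp f.

Lemma dsumP f g : dval f =1 dval g -> f = g.
Proof. by move=> h; apply/fsfunP. Qed.

Lemma dsuppN f x : x \notin dsupp f -> dval f x = 0.
Proof. exact: fsfun_dflt. Qed.

Definition dzero : dsum := [fsfun].
Definition dopp f : dsum := [fsfun x in dsupp f => - dval f x].
Definition dadd f g : dsum :=
  [fsfun x in (dsupp f `|` dsupp g)%fset => (dval f x + dval g x)%R].
Definition delta (x : X) (v : V) : dsum := [fsfun y in [fset x]%fset => v].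

Lemma dzeroE x : dval dzero x = 0. Proof. by rewrite /dval fsfunE. Qed.
Lemma doppE f x : dval (dopp f) x = - dval f x.
Proof.
by rewrite {1}/dval fsfunE; case: ifPn => // /dsuppN ->; rewrite oppr0.
Qed.
Lemma daddE f g x : dval (dadd f g) x = (dval f x + dval g x)%R.
Proof.
rewrite {1}/dval fsfunE; case: ifPn => //.
by rewrite inE negb_or => /andP[/dsuppN -> /dsuppN ->]; rewrite addr0.
Qed.
Lemma deltaE x v y : dval (delta x v) y = if y == x then v else 0.
Proof. by rewrite /dval fsfunE inE. Qed.

Lemma daddA : associative dadd.
Proof. by move=> f g h; apply: dsumP => x; rewrite !daddE addrA. Qed.
Lemma daddC : commutative dadd.
Proof. by move=> f g; apply: dsumP => x; rewrite !daddE addrC. Qed.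
Lemma dadd0 : left_id dzero dadd.
Proof. by move=> f; apply: dsumP => x; rewrite daddE dzeroE add0r. Qed.
Lemma daddN : left_inverse dzero dopp dadd.
Proof. by move=> f; apply: dsumP => x; rewrite daddE doppE dzeroE addNr. Qed.

HB.instance Definition _ := GRing.isZmodule.Build dsum daddA daddC dadd0 daddN.

Lemma dval0 x : dval 0 x = 0. Proof. exact: dzeroE. Qed.
Lemma dvalD f g x : dval (f + g) x = dval f x + dval g x.
Proof. exact: daddE. Qed.
Lemma dvalN f x : dval (- f) x = - dval f x. Proof. exact: doppE. Qed.
Lemma dval_sum I (r : seq I) (F : I -> dsum) x :
  dval (\sum_(i <- r) F i) x = \sum_(i <- r) dval (F i) x.
Proof.
by elim: r => [|i r IH]; rewrite ?big_nil ?dval0 // !big_cons dvalD IH.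
Qed.

Lemma deltaD x : {morph delta x : u v / u + v}.
Proof.
move=> u v; apply: dsumP => y; rewrite dvalD !deltaE.
by case: eqP; rewrite ?addr0.
Qed.

Lemma add_morph0 (U W : zmodType) (h : U -> W) :
  {morph h : u v / u + v} -> h 0 = 0.
Proof. by move=> hD; apply: (addrI (h 0)); rewrite -hD !addr0. Qed.

Lemma add_morph_sum (U W : zmodType) (h : U -> W) I (r : seq I) F :
  {morph h : u v / u + v} -> h (\sum_(i <- r) F i) = \sum_(i <- r) h (F i).
Proof. by move=> hD; apply: big_morph => //; apply: add_morph0. Qed.

Lemma dsumE f : f = \sum_(x <- dsupp f) delta x (dval f x).
Proof.
apply: dsumP => y; rewrite dval_sum.
have [yf|yNf] := boolP (y \in dsupp f).
  rewrite (big_fsetD1 y) //= deltaE eqxx big_seq big1 ?addr0 // => x.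
  by rewrite in_fsetD1 deltaE eq_sym => /andP[/negbTE ->].
rewrite dsuppN // big_seq big1 // => x xf; rewrite deltaE.
by case: eqP xf yNf => // -> ->.
Qed.

(* [dlift phi] extends [delta x v |-> phi x v] additively to the direct sum. *)
Definition dlift (W : zmodType) (phi : X -> V -> W) f : W :=
  \sum_(x <- dsupp f) phi x (dval f x).

Section Dlift.
Variables (W : zmodType) (phi : X -> V -> W).
Hypothesis phiD : forall x, {morph phi x : u v / u + v}.

Lemma dlift_sub (A : {fset X}) f :
  (dsupp f `<=` A)%fset -> dlift phi f = \sum_(x <- A) phi x (dval f x).
Proof.
move=> fA; rewrite /dlift.
rewrite (big_fset_incl _ fA) // => x _ /dsuppN ->.
exact: add_morph0.
Qed.

Lemma dliftD : {morph dlift phi : f g / f + g}.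
Proof.
move=> f g; pose A := (dsupp f `|` dsupp g `|` dsupp (f + g)%R)%fset.
have [fA gA hA] : [/\ dsupp f `<=` A, dsupp g `<=` A & dsupp (f + g)%R `<=` A]%fset.
  by split; apply/fsubsetP => x xf; rewrite !in_fsetU xf ?orbT.
rewrite (dlift_sub fA) (dlift_sub gA) (dlift_sub hA).
by rewrite -big_split; apply: eq_bigr => x _; rewrite dvalD phiD.
Qed.

Lemma dlift_delta x v : dlift phi (delta x v) = phi x v.
Proof.
rewrite (@dlift_sub [fset x]%fset).
  by rewrite big_seq_fset1 deltaE eqxx.
apply/fsubsetP => y; rewrite inE; apply: contraLR => yx.
by rewrite memNfinsupp; apply/eqP; rewrite [LHS]deltaE (negbTE yx).
Qed.
End Dlift.

Lemma dsum_ind (Q : dsum -> Prop) :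
  Q 0 -> (forall f g, Q f -> Q g -> Q (f + g)) ->
  (forall x v, Q (delta x v)) -> forall f, Q f.
Proof. by move=> Q0 QD Qd f; rewrite [f]dsumE; elim/big_ind: _. Qed.

End Dsum.

Section DsumLmod.
Variables (R : pzRingType) (X : choiceType) (V : lmodType R).
Implicit Types f g : dsum X V.

Definition dscale (a : R) f : dsum X V :=
  dlift (fun x v => delta x (a *: v)) f.

Lemma dscaleE a f x : dval (dscale a f) x = a *: dval f x.
Proof.
have h y : {morph (fun v => delta y (a *: v) : dsum X V) : u v / u + v}.
  by move=> u v; rewrite scalerDr deltaD.
elim/dsum_ind: f => [|f g fx gx|y v].
- by rewrite /dscale (add_morph0 (dliftD h)) !dval0 scaler0.
- by rewrite /dscale (dliftD h) !dvalD scalerDr fx gx.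
- rewrite /dscale dlift_delta // !deltaE; case: eqP => //.
  by rewrite scaler0.
Qed.

Lemma dscaleA a b f : dscale a (dscale b f) = dscale (a * b) f.
Proof. by apply: dsumP => x; rewrite !dscaleE scalerA. Qed.
Lemma dscale1 : left_id 1 dscale.
Proof. by move=> f; apply: dsumP => x; rewrite dscaleE scale1r. Qed.
Lemma dscaleDr : right_distributive dscale +%R.
Proof.
by move=> a f g; apply: dsumP => x; rewrite !(dvalD, dscaleE) scalerDr.
Qed.
Lemma dscaleDl f : {morph dscale^~ f : a b / a + b}.
Proof.
by move=> a b; apply: dsumP => x; rewrite !(dvalD, dscaleE) scalerDl.
Qed.
HB.instance Definition _ := GRing.Zmodule_isLmodule.Build R (dsum X V)
  dscaleA dscale1 dscaleDr dscaleDl.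

Lemma dvalZ a f x : dval (a *: f) x = a *: dval f x.
Proof. exact: dscaleE. Qed.

Lemma deltaZ a x (v : V) : delta x (a *: v) = a *: delta x v :> dsum X V.
Proof.
apply: dsumP => y; rewrite dvalZ !deltaE.
by case: eqP => //; rewrite scaler0.
Qed.

Lemma dliftZ (W : lmodType R) (phi : X -> V -> W) :
  (forall x, linear (phi x)) -> linear (dlift phi).
Proof.
move=> phiL.
have phiD x : {morph phi x : u v / u + v}.
  by move=> u v; rewrite -[u]scale1r phiL !scale1r.
have phi0 x : phi x 0 = 0 by exact: (add_morph0 (phiD x)).
move=> a f g; rewrite dliftD //; congr (_ + _).
elim/dsum_ind: f => [|f h fx hx|x v].
- by rewrite scaler0 (add_morph0 (dliftD phiD)) scaler0.
- by rewrite scalerDr !dliftD // scalerDr fx hx.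
- by rewrite -deltaZ !dlift_delta // -[a *: v]addr0 phiL phi0 addr0.
Qed.
End DsumLmod.

Section Conv.
Variables (S : monoidType) (V : zmodType) (m : S -> S -> V -> V -> V).
Hypothesis mDl : forall s t b, {morph m s t ^~ b : a a' / a + a'}.
Hypothesis mDr : forall s t a, {morph m s t a : b b' / b + b'}.

(* The product with delta_s a . delta_t b = delta_(st) (m s t a b). *)
Definition conv (f g : dsum S V) : dsum S V :=
  dlift (fun s a => dlift (fun t b => delta (s * t)%g (m s t a b)) g) f.

Let convr s a : forall t,
  {morph (fun b => delta (s * t)%g (m s t a b) : dsum S V) : b b' / b + b'}.
Proof. by move=> t b b'; rewrite mDr deltaD. Qed.

Let convl g : forall s, {morph (fun a => dlift
  (fun t b => delta (s * t)%g (m s t a b)) g : dsum S V) : a a' / a + a'}.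
Proof.
move=> s a a'; rewrite /dlift -big_split; apply: eq_bigr => t _.
by rewrite mDl deltaD.
Qed.

Lemma convDl : left_distributive conv +%R.
Proof. by move=> f g h; rewrite /conv dliftD. Qed.

Lemma convDr : right_distributive conv +%R.
Proof.
move=> f g h; rewrite /conv /dlift -big_split; apply: eq_bigr => s _.
exact: (dliftD (convr s (dval f s))).
Qed.

Lemma conv_delta s t a b :
  conv (delta s a) (delta t b) = delta (s * t)%g (m s t a b).
Proof. by rewrite /conv !dlift_delta. Qed.

Lemma conv0l g : conv 0 g = 0.
Proof. exact: (add_morph0 (fun f h => convDl f h g)). Qed.
Lemma conv0r f : conv f 0 = 0.
Proof. exact: (add_morph0 (convDr f)). Qed.

Lemma convA : (forall s t u a b c,
    m s (t * u)%g a (m t u b c) = m (s * t)%g u (m s t a b) c) ->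
  associative conv.
Proof.
move=> mA f g h.
elim/dsum_ind: f => [|f f' Hf Hf'|s a]; first by rewrite !conv0l.
  by rewrite !convDl Hf Hf'.
elim/dsum_ind: g => [|g g' Hg Hg'|t b]; first by rewrite !(conv0l, conv0r).
  by rewrite !(convDl, convDr) Hg Hg'.
elim/dsum_ind: h => [|h h' Hh Hh'|u c]; first by rewrite !conv0r.
  by rewrite !convDr Hh Hh'.
by rewrite !conv_delta mA mulgA.
Qed.
End Conv.

(* A K-algebra is a ring together with a ring homomorphism [scal] from K to its
   centre.  Unlike [algType], this structure does not exclude the zero ring, so
   that it is inherited by arbitrary quotients. *)
HB.mixin Record PzRing_isPzAlgebra (K : comPzRingType) A of GRing.PzRing A := {
  scal : K -> A;
  scal1 : scal 1 = 1;
  scalD : {morph scal : k l / k + l};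
  scalM : {morph scal : k l / k * l};
  scalC : forall (k : K) (x : A), scal k * x = x * scal k }.

#[short(type="pzAlgType")]
HB.structure Definition PzAlgebra (K : comPzRingType) :=
  {A of GRing.PzRing A & PzRing_isPzAlgebra K A}.

Section AlgType.
Variables (K : comNzRingType) (A : algType K).
Let alg (k : K) : A := k%:A.
Let alg1 : alg 1 = 1. Proof. exact: scale1r. Qed.
Let algD : {morph alg : k l / k + l}. Proof. by move=> k l; exact: scalerDl. Qed.
Let algM : {morph alg : k l / k * l}.
Proof. by move=> k l; rewrite /alg -scalerAl mul1r scalerA. Qed.
Let algC (k : K) (x : A) : alg k * x = x * alg k.
Proof. by rewrite /alg -scalerAl -scalerAr mul1r mulr1. Qed.
HB.instance Definition _ := PzRing_isPzAlgebra.Build K A alg1 algD algM algC.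
End AlgType.

(* The K-module underlying a module over a K-algebra. *)
Section Restrict.
Variables (K : comPzRingType) (R : pzAlgType K) (V : lmodType R).

Definition restrictT : Type := V.
HB.instance Definition _ := GRing.Zmodule.on restrictT.
Definition restrict_scale (k : K) (v : restrictT) : restrictT :=
  (scal k : R) *: (v : V).

Lemma restrict_scaleA a b v :
  restrict_scale a (restrict_scale b v) = restrict_scale (a * b) v.
Proof. by rewrite /restrict_scale scalerA scalM. Qed.
Lemma restrict_scale1 : left_id 1 restrict_scale.
Proof. by move=> v; rewrite /restrict_scale scal1 scale1r. Qed.
Lemma restrict_scaleDr : right_distributive restrict_scale +%R.
Proof. by move=> a u v; rewrite /restrict_scale scalerDr. Qed.
Lemma restrict_scaleDl v : {morph restrict_scale^~ v : a b / a + b}.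
Proof. by move=> a b; rewrite /restrict_scale scalD scalerDl. Qed.
HB.instance Definition _ := GRing.Zmodule_isLmodule.Build K restrictT
  restrict_scaleA restrict_scale1 restrict_scaleDr restrict_scaleDl.

Definition restrict : lmodType K := restrictT.

Lemma restrictE (k : K) (v : restrict) : k *: v = (scal k : R) *: (v : V).
Proof. by []. Qed.
End Restrict.

Section Ideal.
Variables (K : comPzRingType) (R : pzAlgType K).

Definition two_sided_ideal (I : R -> Prop) : Prop :=
  [/\ I 0, forall x y, I x -> I y -> I (x + y),
      forall a x, I x -> I (a * x) & forall a x, I x -> I (x * a)].

Variable G : R -> Prop.

Definition generated (x : R) : Prop := forall I : R -> Prop,
  two_sided_ideal I -> (forall y, G y -> I y) -> I x.

Lemma generated_ideal : two_sided_ideal generated.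
Proof.
split=> [I []//|x y Ix Iy I II GI|a x Ix I II GI|a x Ix I II GI];
  case: (II) => _ ID Il Ir.
- by apply: ID; [apply: Ix|apply: Iy].
- by apply: Il; apply: Ix.
- by apply: Ir; apply: Ix.
Qed.

Lemma generated_gen x : G x -> generated x.
Proof. by move=> Gx I _; apply. Qed.

Lemma generated_lin (a u v : R^o) :
  generated u -> generated v -> generated (a *: u + v).
Proof.
by case: generated_ideal => _ ID Il _ Iu Iv; apply: ID => //; apply: Il.
Qed.

Definition ideal_gen : submod R^o :=
  Submod (let: And4 I0 _ _ _ := generated_ideal in I0) generated_lin.

Definition quoalg : Type := quoT ideal_gen.
HB.instance Definition _ := GRing.Zmodule.on quoalg.

Definition qcls (x : R) : quoalg := cls ideal_gen x.
Definition qrep (p : quoalg) : R := rep p.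

Lemma qrepK : cancel qrep qcls. Proof. exact: repK. Qed.

Lemma qclsP x y : qcls x = qcls y <-> generated (x - y).
Proof. exact: clsP. Qed.

Lemma qclsB : zmod_morphism qcls.
Proof. by move=> x y; rewrite /qcls raddfB. Qed.
HB.instance Definition _ := GRing.isZmodMorphism.Build R quoalg qcls qclsB.

Definition qmul (p q : quoalg) : quoalg := qcls (qrep p * qrep q).

Lemma qmulE x y : qmul (qcls x) (qcls y) = qcls (x * y).
Proof.
apply/qclsP; case: generated_ideal => _ ID Il Ir.
have h z : generated (qrep (qcls z) - z) by apply/qclsP; rewrite qrepK.
rewrite -[_ - _](subrKA (x * qrep (qcls y))).
rewrite -mulrBl -mulrBr; apply: ID; [exact: Ir|exact: Il].
Qed.

Lemma qmulA : associative qmul.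
Proof.
by move=> p q r; rewrite -[p]qrepK -[q]qrepK -[r]qrepK !qmulE mulrA.
Qed.
Lemma qmul1 : left_id (qcls 1) qmul.
Proof. by move=> p; rewrite -[p]qrepK qmulE mul1r. Qed.
Lemma qmulr1 : right_id (qcls 1) qmul.
Proof. by move=> p; rewrite -[p]qrepK qmulE mulr1. Qed.
Lemma qmulDl : left_distributive qmul +%R.
Proof.
move=> p q r; rewrite -[p]qrepK -[q]qrepK -[r]qrepK.
by rewrite -raddfD !qmulE mulrDl raddfD.
Qed.
Lemma qmulDr : right_distributive qmul +%R.
Proof.
move=> p q r; rewrite -[p]qrepK -[q]qrepK -[r]qrepK.
by rewrite -raddfD !qmulE mulrDr raddfD.
Qed.
HB.instance Definition _ := GRing.Zmodule_isPzRing.Build quoalg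
  qmulA qmul1 qmulr1 qmulDl qmulDr.

Lemma qclsM : {morph qcls : x y / x * y}.
Proof. by move=> x y; rewrite -qmulE. Qed.
Lemma qcls1 : qcls 1 = 1. Proof. by []. Qed.
HB.instance Definition _ := GRing.isMonoidMorphism.Build R quoalg qcls
  (conj qcls1 qclsM).

Definition qscal (k : K) : quoalg := qcls (scal k).
Lemma qscal1 : qscal 1 = 1. Proof. by rewrite /qscal scal1 rmorph1. Qed.
Lemma qscalD : {morph qscal : k l / k + l}.
Proof. by move=> k l; rewrite /qscal scalD rmorphD. Qed.
Lemma qscalM : {morph qscal : k l / k * l}.
Proof. by move=> k l; rewrite /qscal scalM rmorphM. Qed.
Lemma qscalC k p : qscal k * p = p * qscal k.
Proof. by rewrite -[p]qrepK -!qclsM scalC. Qed.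
HB.instance Definition _ :=
  PzRing_isPzAlgebra.Build K quoalg qscal1 qscalD qscalM qscalC.

(* A module killed by the generators is a module over the quotient. *)
Section QuoMod.
Variables (V : lmodType R) (VG : forall g (v : V), G g -> g *: v = 0).

Definition quomod of (forall g (v : V), G g -> g *: v = 0) : Type := V.
Local Notation W := (quomod VG).
HB.instance Definition _ := GRing.Zmodule.on W.

Definition quomod_scale (p : quoalg) (v : W) : W := qrep p *: (v : V).

Lemma quomod_scaleE x v : quomod_scale (qcls x) v = x *: (v : V).
Proof.
suff h y : generated y -> y *: (v : V) = 0.
  apply/eqP; rewrite -subr_eq0 -scalerBl; apply/eqP/h.
  by apply/qclsP; rewrite qrepK.
move=> /(_ (fun y => forall v : V, y *: v = 0)); apply=> [|z Gz u]; last exact: VG.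
split=> [u|a b ha hb u|a b hb u|a b hb u].
- by rewrite scale0r.
- by rewrite scalerDl ha hb addr0.
- by rewrite -scalerA hb scaler0.
- by rewrite -scalerA hb.
Qed.

Lemma quomod_scaleA a b v :
  quomod_scale a (quomod_scale b v) = quomod_scale (a * b) v.
Proof. by rewrite -[a]qrepK -[b]qrepK -qclsM !quomod_scaleE scalerA. Qed.
Lemma quomod_scale1 : left_id 1 quomod_scale.
Proof. by move=> v; rewrite -qcls1 quomod_scaleE scale1r. Qed.
Lemma quomod_scaleDr : right_distributive quomod_scale +%R.
Proof. by move=> a u v; rewrite /quomod_scale scalerDr. Qed.
Lemma quomod_scaleDl v : {morph quomod_scale^~ v : a b / a + b}.
Proof.
move=> a b; rewrite -[a]qrepK -[b]qrepK -raddfD !quomod_scaleE.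
exact: scalerDl.
Qed.
HB.instance Definition _ := GRing.Zmodule_isLmodule.Build quoalg W
  quomod_scaleA quomod_scale1 quomod_scaleDr quomod_scaleDl.
End QuoMod.

End Ideal.

Section MonoidAlgebra.
Variables (K : comPzRingType) (S : monoidType).

Definition monalg : Type := dsum S K^o.
HB.instance Definition _ := GRing.Lmodule.on monalg.

Definition mdelta (s : S) : monalg := delta s (1 : K^o).

Definition mmul : monalg -> monalg -> monalg :=
  @conv S K^o (fun _ _ a b => a * b).

Let mDl (s t : S) (b : K^o) : {morph *%R^~ b : a a' / a + a'}.
Proof. by move=> a a'; rewrite mulrDl. Qed.
Let mDr (s t : S) (a : K^o) : {morph *%R a : b b' / b + b'}.
Proof. by move=> b b'; rewrite mulrDr. Qed.

Lemma mmulDl : left_distributive mmul +%R. Proof. exact: convDl. Qed.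
Lemma mmulDr : right_distributive mmul +%R. Proof. exact: convDr. Qed.
Lemma mmulA : associative mmul.
Proof. by apply: convA => // s t u a b c; rewrite mulrA. Qed.
Lemma mmul_delta s t (a b : K^o) :
  mmul (delta s a) (delta t b) = delta (s * t)%g (a * b).
Proof. by rewrite /mmul conv_delta. Qed.
Lemma mmul1 : left_id (mdelta 1%g) mmul.
Proof.
elim/dsum_ind=> [|f g Hf Hg|t b]; first exact: conv0r.
  by rewrite mmulDr Hf Hg.
by rewrite /mdelta mmul_delta mul1g mul1r.
Qed.
Lemma mmulr1 : right_id (mdelta 1%g) mmul.
Proof.
elim/dsum_ind=> [|f g Hf Hg|t b]; first exact: conv0l.
  by rewrite mmulDl Hf Hg.
by rewrite /mdelta mmul_delta mulg1 mulr1.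
Qed.
HB.instance Definition _ := GRing.Zmodule_isPzRing.Build monalg
  mmulA mmul1 mmulr1 mmulDl mmulDr.

Definition mscal (k : K) : monalg := delta 1%g (k : K^o).
Lemma mscal1 : mscal 1 = 1. Proof. by []. Qed.
Lemma mscalD : {morph mscal : k l / k + l}.
Proof. by move=> k l; rewrite /mscal deltaD. Qed.
Lemma mscalM : {morph mscal : k l / k * l}.
Proof. by move=> k l; rewrite /mscal [RHS]mmul_delta mulg1. Qed.
Lemma mscalC k f : mscal k * f = f * mscal k.
Proof.
elim/dsum_ind: f => [|f f' Hf Hf'|s a]; first by rewrite mul0r mulr0.
  by rewrite mulrDl mulrDr Hf Hf'.
by rewrite [LHS]mmul_delta [RHS]mmul_delta mul1g mulg1 mulrC.
Qed.
HB.instance Definition _ :=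
  PzRing_isPzAlgebra.Build K monalg mscal1 mscalD mscalM mscalC.

Record monrep (V : lmodType K) := Monrep {
  mact : S -> V -> V;
  mact_linear : forall s, linear (mact s);
  mact1 : forall v, mact 1%g v = v;
  mactM : forall s t v, mact (s * t)%g v = mact s (mact t v) }.

Section Repmod.
Variables (V : lmodType K) (rho : monrep V).

Definition repmod of monrep V : Type := V.
Local Notation W := (repmod rho).
HB.instance Definition _ := GRing.Zmodule.on W.

Definition rep_scale (f : monalg) (v : W) : W :=
  dlift (fun s (k : K^o) => k *: mact rho s v : V) f.

Let phiD v s : {morph (fun k : K^o => k *: mact rho s v : V) : a b / a + b}.
Proof. by move=> a b; rewrite scalerDl. Qed.

Lemma rep_scale_delta s k v :
  rep_scale (delta s k) v = (k : K) *: mact rho s v.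
Proof. by rewrite /rep_scale dlift_delta. Qed.

Lemma rep_scaleDl v : {morph rep_scale^~ v : f g / f + g}.
Proof. exact: dliftD. Qed.

Lemma rep_scaleDr : right_distributive rep_scale +%R.
Proof.
move=> f u v; rewrite /rep_scale /dlift -big_split; apply: eq_bigr => s _.
have := mact_linear rho s 1 u v; rewrite !scale1r => /= h.
by rewrite -scalerDr -h.
Qed.

Lemma rep_scale1 : left_id 1 rep_scale.
Proof. by move=> v; rewrite rep_scale_delta mact1 scale1r. Qed.

Lemma rep_scaleA f g v : rep_scale f (rep_scale g v) = rep_scale (f * g) v.
Proof.
have scale0 u : rep_scale 0 u = 0 by apply: (add_morph0 (rep_scaleDl u)).
have scaler0 h : rep_scale h 0 = 0 by apply: (add_morph0 (rep_scaleDr h)).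
elim/dsum_ind: f => [|f f' Hf Hf'|s a]; first by rewrite mul0r !scale0.
  by rewrite mulrDl !rep_scaleDl Hf Hf'.
elim/dsum_ind: g => [|g g' Hg Hg'|t b]; first by rewrite mulr0 scale0 scaler0.
  by rewrite mulrDr !rep_scaleDl rep_scaleDr Hg Hg'.
rewrite [X in _ = rep_scale X v]mmul_delta !rep_scale_delta mactM -scalerA.
congr (_ *: _).
have h := mact_linear rho s.
have h0 : mact rho s 0 = 0.
  by apply: add_morph0 => x y; rewrite -[x]scale1r h !scale1r.
by have := h b (mact rho t v) 0; rewrite h0 !addr0.
Qed.
HB.instance Definition _ := GRing.Zmodule_isLmodule.Build monalg W
  rep_scaleA rep_scale1 rep_scaleDr rep_scaleDl.

Lemma rep_mdelta s (v : W) : mdelta s *: v = mact rho s v.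
Proof. by rewrite [LHS]rep_scale_delta scale1r. Qed.
Lemma rep_scal (k : K) (v : W) : (scal k : monalg) *: v = k *: (v : V).
Proof. by rewrite [LHS]rep_scale_delta mact1. Qed.
End Repmod.

End MonoidAlgebra.

Section Env.
Variables (K : comPzRingType) (R : pzAlgType K).

(* The multiplicative monoid R x R^op. *)
Definition envmon : Type := (R * R)%type.
HB.instance Definition _ := Choice.on envmon.
Definition envmon_mul (p q : envmon) : envmon := (p.1 * q.1, q.2 * p.2).
Lemma envmon_mulA : associative envmon_mul.
Proof. by move=> p q r; rewrite /envmon_mul /= !mulrA. Qed.
Lemma envmon_mul1 : left_id (1, 1) envmon_mul.
Proof. by case=> a b; rewrite /envmon_mul /= mul1r mulr1. Qed.
Lemma envmon_mulr1 : right_id (1, 1) envmon_mul.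
Proof. by case=> a b; rewrite /envmon_mul /= mul1r mulr1. Qed.
HB.instance Definition _ :=
  isMonoid.Build envmon envmon_mulA envmon_mul1 envmon_mulr1.

Let free (a b : R) : monalg K envmon := mdelta K ((a, b) : envmon).

Variant bilinear_relator : monalg K envmon -> Prop :=
| RelLeft k a a' b :
    bilinear_relator
      (free (scal k * a + a') b - (scal k * free a b + free a' b))
| RelRight k a b b' :
    bilinear_relator
      (free a (scal k * b + b') - (scal k * free a b + free a b')).

(* R (x)_K R^op: the free K-module on pairs, with (a, b)(c, d) = (ac, db),
   modulo K-bilinearity. *)
Definition env : pzAlgType K := quoalg bilinear_relator.

Definition tens (a b : R) : env := qcls bilinear_relator (free a b).

Lemma tensM a b c d : tens a b * tens c d = tens (a * c) (d * b).
Proof. by rewrite /tens -qclsM [free a b * _]mmul_delta mulr1. Qed.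
Lemma tens1 : tens 1 1 = 1. Proof. by []. Qed.

(* R as a module over its enveloping algebra: (a (x) b) x = a x b. *)
Local Notation RK := (restrict (R^o : lmodType R)).

Lemma reg_linear (p : envmon) : linear (fun x : RK => p.1 * x * p.2 : RK).
Proof.
move=> k x y; rewrite mulrDr mulrDl; congr (_ + _).
rewrite !restrictE /GRing.scale /=.
by rewrite mulrA -scalC -!mulrA.
Qed.
Lemma reg_act1 (x : RK) : (1%g : envmon).1 * x * (1%g : envmon).2 = x.
Proof. by rewrite mul1r mulr1. Qed.
Lemma reg_actM (p q : envmon) (x : RK) :
  (p * q)%g.1 * x * (p * q)%g.2 = p.1 * (q.1 * x * q.2) * p.2.
Proof. by rewrite /= !mulrA. Qed.
Definition reg_rep : monrep envmon RK := Monrep reg_linear reg_act1 reg_actM.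

Lemma reg_relator g (x : repmod reg_rep) :
  bilinear_relator g -> g *: x = 0.
Proof.
have E a b : free a b *: x = (a * (x : R) * b : R) by apply: rep_mdelta.
case=> [k a a' b|k a b b']; apply/eqP; rewrite scalerBl scalerDl subr_eq0;
  apply/eqP; rewrite -scalerA !E rep_scal restrictE /GRing.scale /=.
- by rewrite !mulrDl !mulrA.
- by rewrite mulrDr [_ * (scal k * b)]mulrA -[_ * scal k]scalC -!mulrA.
Qed.

Definition reg : lmodType env := quomod reg_relator.

Lemma reg_tens a b (x : reg) : tens a b *: x = (a * (x : R) * b : R).
Proof. by rewrite [LHS]quomod_scaleE [LHS]rep_mdelta. Qed.
End Env.

Definition projective (R : pzRingType) (P : lmodType R) : Prop :=
  forall (U V : lmodType R) (g : {linear U -> V}) (f : {linear P -> V}),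
    (forall v, exists u, g u = v) ->
    exists h : {linear P -> U}, forall x, g (h x) = f x.

Section Resolution.
Variable R : pzRingType.

Record resolution (M : lmodType R) := Resolution {
  rmod : nat -> lmodType R;
  rdiff : forall n, {linear rmod n.+1 -> rmod n};
  raug : {linear rmod 0 -> M};
  rmod_projective : forall n, projective (rmod n);
  raug_surj : forall x, exists y, raug y = x;
  raug_exact : forall y, raug y = 0 <-> exists z, rdiff 0 z = y;
  rdiff_exact : forall n y,
    rdiff n y = 0 <-> exists z, rdiff n.+1 z = y }.

Definition ker_sub (U V : lmodType R) (g : {linear U -> V}) : submod U.
Proof.
apply: (@Submod _ _ (fun x => g x = 0)); first exact: raddf0.
by move=> a u v gu gv; rewrite linearP gu gv scaler0 addr0.
Defined.

Definition free_mod (X : choiceType) : lmodType R := dsum X R^o.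

(* The linear map [free_mod M -> M] sending the basis element at x to x. *)
Definition eps (M : lmodType R) (f : free_mod M) : M :=
  dlift (fun (x : M) (a : R^o) => (a : R) *: x) f.

Lemma eps_linear (M : lmodType R) : linear (@eps M).
Proof.
apply: dliftZ => x a u v; rewrite scalerDl; congr (_ + _).
by rewrite scalerA.
Qed.
HB.instance Definition _ (M : lmodType R) := GRing.isLinear.Build R (free_mod M) M *:%R
  (@eps M) (@eps_linear M).

Lemma eps_delta (M : lmodType R) (x : M) : eps (delta x (1 : R^o)) = x.
Proof.
rewrite /eps dlift_delta ?scale1r // => y a b; exact: scalerDl.
Qed.

Fixpoint syzygy (M : lmodType R) (n : nat) : lmodType R :=
  if n is n'.+1 then subT (ker_sub (@eps (syzygy M n'))) else M.

Definition free_diff (M : lmodType R) (n : nat)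
    (f : free_mod (syzygy M n.+1)) : free_mod (syzygy M n) :=
  val (eps f : subT (ker_sub (@eps (syzygy M n)))).

Lemma free_diff_linear (M : lmodType R) n : linear (@free_diff M n).
Proof. by move=> a f g; rewrite /free_diff !linearP. Qed.
HB.instance Definition _ (M : lmodType R) n := GRing.isLinear.Build R
  (free_mod (syzygy M n.+1)) (free_mod (syzygy M n)) *:%R
  (@free_diff M n) (@free_diff_linear M n).

Lemma free_projective X : projective (free_mod X).
Proof.
move=> U V g f g_surj.
pose c x := projT1 (cid (g_surj (f (delta x (1 : R^o))))).
have gc x : g (c x) = f (delta x (1 : R^o)) by rewrite /c; case: cid.
pose h (p : free_mod X) : U := dlift (fun x (a : R^o) => (a : R) *: c x) p.
have hL : linear h.
  by apply: dliftZ => x a u v; rewrite scalerDl -scalerA.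
pose hM := GRing.isLinear.Build R (free_mod X) U *:%R h hL.
pose H : {linear free_mod X -> U} := HB.pack h hM.
have hD : {morph h : p q / p + q} by move=> p q; exact: (linearD H).
exists H => p; change (g (h p) = f p).
elim/dsum_ind: p => [|p q Hp Hq|x a].
- by rewrite (add_morph0 hD) !linear0.
- by rewrite hD (linearD g) Hp Hq -(linearD f).
- rewrite /h dlift_delta => [|y u v]; last exact: scalerDl.
  by rewrite linearZ /= gc -linearZ -deltaZ /GRing.scale /= mulr1.
Qed.

Lemma free_aug_exact (M : lmodType R) (y : free_mod (syzygy M 0)) :
  eps y = 0 <-> exists z, @free_diff M 0 z = y.
Proof.
split=> [y0|[z <-]]; last exact: (@subTP _ _ (ker_sub (@eps M)) (eps z)).
exists (delta (subI (P := ker_sub (@eps M)) y0) (1 : R^o)).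
by rewrite /free_diff eps_delta.
Qed.

Lemma free_diff_exact (M : lmodType R) n (y : free_mod (syzygy M n.+1)) :
  @free_diff M n y = 0 <-> exists z, @free_diff M n.+1 z = y.
Proof.
split=> [y0|[z <-]].
  have {}y0 : eps y = 0 by apply: val_inj; rewrite raddf0.
  exists (delta (subI (P := ker_sub (@eps (syzygy M n.+1))) y0) (1 : R^o)).
  by rewrite /free_diff eps_delta.
rewrite {1}/free_diff; have -> : eps (free_diff z) = 0 by apply: (@subTP _ _ (ker_sub (@eps (syzygy M n.+1))) (eps z)).
by rewrite raddf0.
Qed.

(* The canonical free resolution: each term is free on the underlying set of
   the preceding syzygy. *)
Definition free_resolution (M : lmodType R) : resolution M :=
  @Resolution M (fun n => free_mod (syzygy M n))
    (fun n => @free_diff M n : {linear _ -> _})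
    (@eps M : {linear free_mod (syzygy M 0) -> M})
    (fun n => @free_projective (syzygy M n))
    (fun x => ex_intro _ (delta (x : M) (1 : R^o)) (eps_delta x))
    (@free_aug_exact M) (@free_diff_exact M).

End Resolution.

Section Cohomology.
Variables (K : pzRingType) (U V W : lmodType K).
Variables (f : {linear U -> V}) (g : {linear V -> W}).

Definition boundaries : submod (subT (ker_sub g)).
Proof.
apply: (@Submod _ _ (fun z => exists u, f u = val z)).
  by exists 0; rewrite !raddf0.
by move=> a z z' [u hu] [v hv]; exists (a *: u + v); rewrite !linearP hu hv.
Defined.

(* ker g / im f *)
Definition cohomology : lmodType K := quoT boundaries.
End Cohomology.

Section Ext.
Variables (K : comPzRingType) (R : pzAlgType K).

Definition linear_sub (P N : lmodType R) : submod (P -> restrict N).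
Proof.
apply: (@Submod _ (P -> restrict N) (fun h => linear (h : P -> N))).
  by move=> a u v; rewrite /= scaler0 addr0.
move=> k h h' hL hL' a u v; have E w : (k *: h + h') w = scal k *: (h w : N) + h' w by [].
rewrite !E hL hL' !scalerDr !scalerA scalC.
by rewrite addrACA.
Defined.

(* Hom_R(P, N), as a K-module. *)
Definition homT (P N : lmodType R) : lmodType K := subT (linear_sub P N).

Section Precomp.
Variables (P Q N : lmodType R) (d : {linear Q -> P}).

Lemma precomp_subproof (h : homT P N) : linear_sub Q N (val h \o d).
Proof. by move=> a u v; rewrite /= linearP (subTP h). Qed.
Definition precomp (h : homT P N) : homT Q N := subI (precomp_subproof h).
Lemma precomp_linear : linear precomp.
Proof. by move=> a u v; apply: val_inj; rewrite linearP. Qed.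
HB.instance Definition _ := GRing.isLinear.Build K (homT P N) (homT Q N) *:%R
  precomp precomp_linear.
End Precomp.
Arguments precomp {P Q} N d h.

(* The n-th cohomology of Hom_R(P_*, N) for a projective resolution P_* of M. *)
Definition Ext_of (M : lmodType R) (P : resolution M) (N : lmodType R)
    (n : nat) : lmodType K :=
  match n with
  | 0 => cohomology (\0 : {linear homT (rmod P 0) N -> homT (rmod P 0) N})
           (precomp N (rdiff P 0))
  | n'.+1 => cohomology (precomp N (rdiff P n')) (precomp N (rdiff P n'.+1))
  end.

Definition Ext (n : nat) (M N : lmodType R) : lmodType K :=
  Ext_of (free_resolution M) N n.
End Ext.

Section InverseFacts.
Local Open Scope group_scope.
Variables (S : monoidType) (inv : S -> S).
Implicit Types s t e f : S.
Hypotheses (mulgVg : forall s, s * inv s * s = s)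
  (mulVgV : forall s, inv s * s * inv s = inv s)
  (inv_uniq : forall s t, s * t * s = s -> t * s * t = t -> t = inv s).

Lemma idem_inv e : e * e = e -> inv e = e.
Proof. by move=> ee; apply/esym/inv_uniq; rewrite !ee. Qed.

Lemma inverse_invK : involutive inv.
Proof. by move=> s; apply/esym/inv_uniq. Qed.

Lemma idem_mul e f : e * e = e -> f * f = f -> (e * f) * (e * f) = e * f.
Proof.
move=> ee ff; pose x := inv (e * f).
have h1 : x * (e * f) * x = x by apply: mulVgV.
have h2 : (e * f) * x * (e * f) = e * f by apply: mulgVg.
have hx : x = f * x * e.
  apply/esym/inv_uniq.
    rewrite -[RHS]h2 !mulgA -[e * f * f]mulgA ff.
    by rewrite -[_ * e * e]mulgA ee.
  rewrite -[in RHS]h1 !mulgA -[_ * e * e]mulgA ee.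
  by rewrite -[_ * f * f]mulgA ff.
have xx : x * x = x.
  by rewrite {1 2}hx [RHS]hx -[in RHS]h1 !mulgA.
have : inv x = e * f by rewrite /x inverse_invK.
by rewrite (idem_inv xx) => <-.
Qed.

Lemma idem_comm e f : e * e = e -> f * f = f -> e * f = f * e.
Proof.
move=> ee ff; have ef := idem_mul ee ff; have fe := idem_mul ff ee.
rewrite -[LHS](idem_inv ef); apply/esym/inv_uniq.
  rewrite !mulgA -[e * f * f]mulgA ff -[_ * e * e]mulgA ee.
  by rewrite -[RHS]ef !mulgA.
rewrite !mulgA -[f * e * e]mulgA ee -[_ * f * f]mulgA ff.
by rewrite -[RHS]fe !mulgA.
Qed.

Lemma idem_gV s : (s * inv s) * (s * inv s) = s * inv s.
Proof. by rewrite mulgA mulgVg. Qed.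
Lemma idem_Vg s : (inv s * s) * (inv s * s) = inv s * s.
Proof. by rewrite mulgA mulVgV. Qed.

Lemma inverse_invM : {morph inv : s t / s * t >-> t * s}.
Proof.
move=> s t; apply/esym/inv_uniq.
  have -> : s * t * (inv t * inv s) * (s * t)
          = s * ((t * inv t) * (inv s * s)) * t by rewrite !mulgA.
  rewrite (idem_comm (idem_gV t) (idem_Vg s)) !mulgA mulgVg.
  by rewrite -!mulgA [t * _]mulgA mulgVg.
have -> : inv t * inv s * (s * t) * (inv t * inv s)
        = inv t * ((inv s * s) * (t * inv t)) * inv s by rewrite !mulgA.
rewrite (idem_comm (idem_Vg s) (idem_gV t)) !mulgA mulVgV.
by rewrite -!mulgA [inv s * _]mulgA mulVgV.
Qed.
End InverseFacts.

(* The anti-automorphism axioms of [StarMonoid] follow from the existence and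
   uniqueness of inverses: see the factory below. *)
HB.mixin Record StarMonoid_isInverseMonoid S of StarMonoid S := {
  mulgVg : forall s : S, (s * s^-1 * s = s)%g;
  inv_uniq : forall s t : S,
    (s * t * s = s)%g -> (t * s * t = t)%g -> t = (s^-1)%g }.

#[short(type="inverseMonoidType")]
HB.structure Definition InverseMonoid :=
  {S of StarMonoid S & StarMonoid_isInverseMonoid S}.

HB.factory Record Monoid_isInverseMonoid S of Monoid S := {
  inv : S -> S;
  mulgVg : forall s : S, (s * inv s * s = s)%g;
  mulVgV : forall s : S, (inv s * s * inv s = inv s)%g;
  inv_uniq : forall s t : S,
    (s * t * s = s)%g -> (t * s * t = t)%g -> t = inv s }.

HB.builders Context S of Monoid_isInverseMonoid S.
HB.instance Definition _ := hasInv.Build S inv.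
HB.instance Definition _ := Monoid_isStarMonoid.Build S
  (inverse_invK mulgVg mulVgV inv_uniq) (inverse_invM mulgVg mulVgV inv_uniq).
HB.instance Definition _ := StarMonoid_isInverseMonoid.Build S mulgVg inv_uniq.
HB.end.

Section InverseMonoidTheory.
Local Open Scope group_scope.
Variable S : inverseMonoidType.
Implicit Types s t e f : S.

Lemma mulVgV s : s^-1 * s * s^-1 = s^-1.
Proof. by have := mulgVg s^-1; rewrite invgK. Qed.

Definition idempotent (e : S) : bool := e * e == e.

(* The natural partial order. *)
Definition nle (s t : S) : Prop := exists2 e, idempotent e & s = e * t.

Lemma idempotent_comm e f : idempotent e -> idempotent f -> e * f = f * e.
Proof.
by move=> /eqP ee /eqP ff; exact: (idem_comm (@mulgVg S) mulVgV (@inv_uniq S)).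
Qed.

Lemma idempotent_gV s : idempotent (s * s^-1).
Proof. by apply/eqP/(idem_gV (@mulgVg S)). Qed.

Lemma idempotent_Vg s : idempotent (s^-1 * s).
Proof. by apply/eqP/(idem_Vg mulVgV). Qed.

Lemma idempotent_conj s e : idempotent e -> idempotent (s * e * s^-1).
Proof.
move=> ee; apply/eqP.
have -> : s * e * s^-1 * (s * e * s^-1) = s * e * (s^-1 * s * e) * s^-1.
  by rewrite !mulgA.
rewrite (idempotent_comm (idempotent_Vg s) ee) !mulgA.
rewrite -[_ * e * e]mulgA (eqP ee).
by rewrite -!mulgA [s^-1 * _]mulgA mulVgV.
Qed.
End InverseMonoidTheory.

(* Partial bijections of T, as injective partial functions. *)
Record pbij (T : Type) := Pbij {
  pfun :> T -> option T;
  pfun_inj : forall x y z, pfun x = Some z -> pfun y = Some z -> x = y }.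

Section Pbij.
Variable T : Type.
Implicit Types f g : pbij T.

Definition pdom f (x : T) : Prop := exists y, f x = Some y.
Definition pran f (y : T) : Prop := exists x, f x = Some y.

Lemma pcomp_inj f g x y z :
  obind f (g x) = Some z -> obind f (g y) = Some z -> x = y.
Proof.
case gx: (g x) => [x'|//] /= fx; case gy: (g y) => [y'|//] /= fy.
by apply: pfun_inj gx _; rewrite gy (pfun_inj fx fy).
Qed.
(* Composition in the symmetric inverse monoid: first g, then f. *)
Definition pcomp f g : pbij T := Pbij (@pcomp_inj f g).
End Pbij.

Section Action.
Variables (K : comPzRingType) (S : inverseMonoidType) (A : pzAlgType K).

Record unital_action := UnitalAction {
  theta : S -> pbij A;
  uone : S -> A;
  thetaM : forall s t, theta (s * t)%g =1 pcomp (theta s) (theta t);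
  theta_dom : forall s, two_sided_ideal (pdom (theta s));
  theta_ran : forall s, two_sided_ideal (pran (theta s));
  thetaD : forall s x y x' y', theta s x = Some x' -> theta s y = Some y' ->
    theta s (x + y) = Some (x' + y');
  thetaZ : forall s (k : K) x x', theta s x = Some x' ->
    theta s (scal k * x) = Some (scal k * x');
  theta_mul : forall s x y x' y', theta s x = Some x' -> theta s y = Some y' ->
    theta s (x * y) = Some (x' * y');
  theta1 : forall x, theta 1%g x = Some x;
  uone_idem : forall s, uone s * uone s = uone s;
  uone_central : forall s x, uone s * x = x * uone s;
  theta_ranE : forall s y, pran (theta s) y <-> exists a, y = uone s * a }.

Variable th : unital_action.
Local Notation "1_ s" := (uone th s) (at level 8, s at level 2, format "1_ s").

(* theta_s (1_(s^-1) x) *)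
Definition act (s : S) (x : A) : A := odflt 0 (theta th s (1_(s^-1)%g * x)).

Lemma theta_inv s x y : theta th s x = Some y <-> theta th s^-1%g y = Some x.
Proof.
have half u a b : theta th u a = Some b -> theta th u^-1%g b = Some a.
  move=> uab; have := thetaM th (u * u^-1)%g u a.
  rewrite mulgVg /= uab /= thetaM /=.
  case uVb: (theta th u^-1%g b) => [c|//] /= /esym uc.
  by rewrite (pfun_inj uc uab).
by split=> [/half//|/half]; rewrite invgK.
Qed.

Lemma pdomE s x : pdom (theta th s) x <-> 1_(s^-1)%g * x = x.
Proof.
have <- : pran (theta th s^-1%g) x <-> pdom (theta th s) x.
  by split=> -[y h]; exists y; apply/theta_inv => //; rewrite ?invgK.
rewrite theta_ranE; split=> [[a ->]|<-]; last by exists x.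
by rewrite mulrA uone_idem.
Qed.

Lemma pranE s y : pran (theta th s) y <-> 1_s * y = y.
Proof.
rewrite theta_ranE; split=> [[a ->]|<-]; last by exists y.
by rewrite mulrA uone_idem.
Qed.

Lemma actE s x : theta th s (1_(s^-1)%g * x) = Some (act s x).
Proof.
rewrite /act; have [y ->//] : pdom (theta th s) (1_(s^-1)%g * x).
by apply/pdomE; rewrite mulrA uone_idem.
Qed.

Lemma act_ran s x : 1_s * act s x = act s x.
Proof. by apply/pranE; exists (1_(s^-1)%g * x); apply: actE. Qed.

Lemma actM s : {morph act s : x y / x * y}.
Proof.
move=> x y; apply: Some_inj; rewrite -actE -(theta_mul (actE s x) (actE s y)).
by rewrite -mulrA [x * (_ * y)]mulrA -uone_central !mulrA uone_idem.
Qed.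

Lemma actD s : {morph act s : x y / x + y}.
Proof.
move=> x y; apply: Some_inj; rewrite -actE -(thetaD (actE s x) (actE s y)).
by rewrite mulrDr.
Qed.

Lemma act1 s : act s 1 = 1_s.
Proof.
have [x hx] : pran (theta th s) 1_s by apply/pranE; rewrite uone_idem.
have xd : 1_(s^-1)%g * x = x by apply/pdomE; exists 1_s.
have : Some (act s 1 * 1_s) = Some 1_s.
  by rewrite -(theta_mul (actE s 1) hx) mulr1 xd.
by case; rewrite -uone_central act_ran.
Qed.

Lemma uone1 : 1_(1%g) = 1.
Proof.
have /pranE : pran (theta th 1%g) (1 : A) by exists 1; apply: theta1.
by rewrite mulr1.
Qed.

Lemma act1g x : act 1%g x = x.
Proof.
by apply: Some_inj; rewrite -actE theta1 invg1 uone1 mul1r.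
Qed.

Lemma act_comp s t x : act s (act t x) = act (s * t)%g x.
Proof.
pose w := 1_(s^-1)%g * act t x; pose e := 1_((s * t)^-1)%g.
have sw : theta th s w = Some (act s (act t x)) by apply: actE.
have [y ty] : pran (theta th t) w.
  by apply/pranE; rewrite /w mulrA uone_central -mulrA act_ran.
have sty : theta th (s * t)%g y = Some (act s (act t x)).
  by rewrite thetaM /= ty.
have ey : e * y = y by apply/pdomE; exists (act s (act t x)).
suff exy : e * x = y by apply: Some_inj; rewrite -[RHS]actE -/e exy sty.
have [z ste] : pdom (theta th (s * t)%g) e.
  by apply/pdomE; rewrite uone_idem.
move: ste; rewrite thetaM /=; case te: (theta th t e) => [e'|//] /= se'.
have e'd : 1_(s^-1)%g * e' = e' by apply/pdomE; exists z.
have tex : theta th t (e * (1_(t^-1)%g * x)) = Some (e' * w).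
  rewrite (theta_mul te (actE t x)) /w mulrA.
  by rewrite -[e' * 1_ _]uone_central e'd.
have tey : theta th t (e * y) = Some (e' * w) by rewrite (theta_mul te ty).
have e1 : e * 1_(t^-1)%g = e.
  by rewrite -uone_central; apply/pdomE; exists e'.
by have := pfun_inj tex tey; rewrite mulrA e1 ey.
Qed.

Lemma act_idem e x : idempotent e -> act e x = 1_e * x.
Proof.
move=> /eqP ee.
have ev : (e^-1 = e)%g by apply/esym/inv_uniq; rewrite !ee.
have := actE e (act e x); rewrite ev act_ran act_comp ee => h.
by have := actE e x; rewrite ev => /(pfun_inj h).
Qed.

Lemma uone_gV s : 1_(s * s^-1)%g = 1_s.
Proof.
rewrite -act1 -act_comp act1; apply: Some_inj; rewrite -actE uone_idem.
by have := actE s 1; rewrite mulr1 act1.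
Qed.

Lemma act_gV s x : act s (act s^-1%g x) = 1_s * x.
Proof. by rewrite act_comp act_idem ?idempotent_gV // uone_gV. Qed.

Lemma uone_le s t : 1_s * 1_(s * t)%g = 1_(s * t)%g.
Proof. by rewrite -[1_(s * t)%g]act1 -act_comp act_ran. Qed.

Definition ltwist (s t : S) (a b : A^o) : A^o := (a : A) * act s b.
Lemma ltwistDl s t b : {morph ltwist s t ^~ b : a a' / a + a'}.
Proof. by move=> a a'; rewrite /ltwist mulrDl. Qed.
Lemma ltwistDr s t a : {morph ltwist s t a : b b' / b + b'}.
Proof. by move=> b b'; rewrite /ltwist actD mulrDr. Qed.

Definition lconv : dsum S A^o -> dsum S A^o -> dsum S A^o := conv ltwist.

Lemma lconvA : associative lconv.
Proof.
apply: (convA ltwistDl ltwistDr) => s t u a b c.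
by rewrite /ltwist actM act_comp mulrA.
Qed.

Lemma lconv_delta s t (a b : A) :
  lconv (delta s (a : A^o)) (delta t (b : A^o))
  = delta (s * t)%g (a * act s b : A).
Proof. exact: (conv_delta ltwistDl ltwistDr). Qed.

Lemma lconvDl : left_distributive lconv +%R.
Proof. exact: (convDl ltwistDl). Qed.
Lemma lconvDr : right_distributive lconv +%R.
Proof. exact: (convDr ltwistDr). Qed.

(* The left A-submodule of families (a_s) with a_s in 1_s A. *)
Definition Lpred (f : dsum S A^o) : Prop :=
  forall s, exists a : A, dval f s = 1_s * a.
Lemma Lpred0 : Lpred 0.
Proof. by move=> s; exists 0; rewrite dval0 mulr0. Qed.
Lemma LpredP (a : A) f g : Lpred f -> Lpred g -> Lpred (a *: f + g).
Proof.
move=> hf hg s; have [[b hb] [c hc]] := (hf s, hg s).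
exists (a * b + c); rewrite dvalD dvalZ hb hc mulrDr; congr (_ + _).
by rewrite /GRing.scale /= !mulrA -uone_central.
Qed.
Definition Lsub : submod (dsum S A^o) := Submod Lpred0 LpredP.

Definition Lalg : Type := subT Lsub.
HB.instance Definition _ := GRing.Zmodule.on Lalg.

Lemma Lmem f : Lsub f <-> forall s, 1_s * dval f s = dval f s.
Proof.
split=> h s; last by exists (dval f s); rewrite h.
by have [a ->] := h s; rewrite mulrA uone_idem.
Qed.

Lemma Ldelta_mem s a : Lsub (delta s (1_s * a : A)).
Proof.
move=> t; rewrite deltaE; case: eqP => [->|_]; first by exists a.
by exists 0; rewrite mulr0.
Qed.

(* [Ldelta s a] is (1_s a) delta_s, that is a delta_s when a is in 1_s A. *)
Definition Ldelta (s : S) (a : A) : Lalg := subI (Ldelta_mem s a).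

Lemma Lmem0 : Lsub 0. Proof. exact: smem0. Qed.
Lemma LmemD f g : Lsub f -> Lsub g -> Lsub (f + g).
Proof. by move=> hf hg; rewrite -[f]scale1r; apply: smemP. Qed.

Definition lval (f : Lalg) : dsum S A^o := val (f : subT Lsub).
Lemma lval_inj : injective lval. Proof. exact: val_inj. Qed.
Lemma lval_mem f : Lsub (lval f). Proof. exact: subTP. Qed.
Lemma lvalI f (hf : Lsub f) : lval (subI hf) = f. Proof. by []. Qed.
Lemma lval0 : lval 0 = 0. Proof. by []. Qed.
Lemma lvalD f g : lval (f + g) = lval f + lval g. Proof. by []. Qed.
Lemma lval_delta s a : lval (Ldelta s a) = delta s (1_s * a : A).
Proof. by []. Qed.

Lemma lvalE f :
  lval f = \sum_(s <- dsupp (lval f)) delta s (1_s * dval (lval f) s : A).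
Proof.
rewrite [LHS]dsumE; apply: eq_bigr => s _.
by have /Lmem -> := lval_mem f.
Qed.

Lemma lconv_mem f g : Lsub f -> Lsub g -> Lsub (lconv f g).
Proof.
move=> hf hg.
have lconv0l h : lconv 0 h = 0 by exact: (add_morph0 (fun f h' => lconvDl f h' h)).
have lconv0r h : lconv h 0 = 0 by exact: (add_morph0 (lconvDr h)).
rewrite -(lvalI hf) -(lvalI hg) (lvalE (subI hf)) (lvalE (subI hg)).
elim/big_ind: _ => [|x y hx hy|s _].
- by rewrite lconv0l; exact: Lmem0.
- by rewrite lconvDl; exact: LmemD.
elim/big_ind: _ => [|x y hx hy|t _].
- by rewrite lconv0r; exact: Lmem0.
- by rewrite lconvDr; exact: LmemD.
have act1t : act s 1_t = 1_(s * t)%g by rewrite -[1_t]act1 act_comp act1.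
rewrite lconv_delta actM act1t mulrA -uone_central -mulrA.
exact: Ldelta_mem.
Qed.

Definition Lmul (f g : Lalg) : Lalg := subI (lconv_mem (lval_mem f) (lval_mem g)).
Lemma lvalM f g : lval (Lmul f g) = lconv (lval f) (lval g). Proof. by []. Qed.

Lemma LmulA : associative Lmul.
Proof. by move=> f g h; apply: lval_inj; rewrite !lvalM lconvA. Qed.
Lemma LmulDl : left_distributive Lmul +%R.
Proof. by move=> f g h; apply: lval_inj; rewrite !(lvalM, lvalD) lconvDl. Qed.
Lemma LmulDr : right_distributive Lmul +%R.
Proof. by move=> f g h; apply: lval_inj; rewrite !(lvalM, lvalD) lconvDr. Qed.

Lemma LdeltaD (s : S) : {morph Ldelta s : a b / a + b}.
Proof.
by move=> a b; apply: lval_inj; rewrite !(lvalD, lval_delta) mulrDr deltaD.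
Qed.

Lemma L_ind (Q : Lalg -> Prop) :
  Q 0 -> (forall f g, Q f -> Q g -> Q (f + g)) ->
  (forall s a, Q (Ldelta s a)) -> forall f, Q f.
Proof.
move=> Q0 QD Qd f.
have -> : f = \sum_(s <- dsupp (lval f)) Ldelta s (dval (lval f) s).
  apply: lval_inj; rewrite [LHS]lvalE (big_morph _ lvalD lval0).
  by apply: eq_bigr => s _; rewrite lval_delta.
by elim/big_ind: _.
Qed.

Lemma Lmul_delta s t a b :
  Lmul (Ldelta s a) (Ldelta t b) = Ldelta (s * t)%g (a * act s b).
Proof.
apply: lval_inj; rewrite lvalM !lval_delta lconv_delta actM.
have act1t : act s 1_t = 1_(s * t)%g by rewrite -[1_t]act1 act_comp act1.
congr (delta _ _); rewrite act1t mulrA -uone_central !mulrA.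
by rewrite -[_ * 1_s]uone_central uone_le.
Qed.

Lemma Lmul1 : left_id (Ldelta 1%g 1) Lmul.
Proof.
elim/L_ind => [|f g Hf Hg|t b].
- exact: (add_morph0 (LmulDr _)).
- by rewrite LmulDr Hf Hg.
- by rewrite Lmul_delta mul1g mul1r act1g.
Qed.
Lemma Lmulr1 : right_id (Ldelta 1%g 1) Lmul.
Proof.
elim/L_ind => [|f g Hf Hg|s a].
- exact: (add_morph0 (fun f g => LmulDl f g _)).
- by rewrite LmulDl Hf Hg.
- rewrite Lmul_delta mulg1 act1 -uone_central; apply: lval_inj.
  by rewrite !lval_delta mulrA uone_idem.
Qed.
HB.instance Definition _ := GRing.Zmodule_isPzRing.Build Lalg
  LmulA Lmul1 Lmulr1 LmulDl LmulDr.

Lemma LdeltaM s t a b :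
  Ldelta s a * Ldelta t b = Ldelta (s * t)%g (a * act s b).
Proof. exact: Lmul_delta. Qed.

Lemma act_scal s k x : act s (scal k * x) = scal k * act s x.
Proof.
apply: Some_inj; rewrite -actE -(thetaZ k (actE s x)).
by rewrite mulrA -scalC mulrA.
Qed.

Definition Lscal (k : K) : Lalg := Ldelta 1%g (scal k).
Lemma Lscal1 : Lscal 1 = 1. Proof. by rewrite /Lscal scal1. Qed.
Lemma LscalD : {morph Lscal : k l / k + l}.
Proof. by move=> k l; rewrite /Lscal scalD LdeltaD. Qed.
Lemma LscalM : {morph Lscal : k l / k * l}.
Proof. by move=> k l; rewrite /Lscal LdeltaM mulg1 act1g scalM. Qed.
Lemma LscalC k f : Lscal k * f = f * Lscal k.
Proof.
elim/L_ind: f => [|f g Hf Hg|s a]; first by rewrite mul0r mulr0.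
  by rewrite mulrDl mulrDr Hf Hg.
rewrite /Lscal !LdeltaM mul1g mulg1 act1g -[X in act s X]mulr1 act_scal act1.
apply: lval_inj; rewrite !lval_delta; congr (delta _ _).
have -> : a * (scal k * 1_s) = 1_s * (scal k * a).
  by rewrite mulrA -scalC uone_central.
by rewrite [RHS]mulrA uone_idem.
Qed.
HB.instance Definition _ :=
  PzRing_isPzAlgebra.Build K Lalg Lscal1 LscalD LscalM LscalC.

(* The elements a delta_s - a delta_t with s <= t and a in 1_s A. *)
Definition order_relator (w : Lalg) : Prop := exists s t (a : A), nle s t /\
  lval w = (delta s (1_s * a : A) - delta t (1_s * a : A) : dsum S A^o).

Definition crossed : pzAlgType K := quoalg order_relator.

(* The class of a delta_1. *)
Definition incl (a : A) : crossed := qcls order_relator (Ldelta 1%g a).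
(* The class of 1_s delta_s. *)
Definition unitd (s : S) : crossed := qcls order_relator (Ldelta s 1).

Lemma unitdM s t : unitd s * unitd t = unitd (s * t)%g.
Proof.
rewrite /unitd -qclsM LdeltaM act1 mul1r; congr qcls.
apply: lval_inj; rewrite !lval_delta; congr (delta _ _).
by rewrite -uone_central uone_le mulr1.
Qed.

Lemma unitd1 : unitd 1%g = 1. Proof. by []. Qed.

Lemma incl_unitd a s : incl a * unitd s = unitd s * incl (act s^-1%g a).
Proof.
rewrite /incl /unitd -!qclsM !LdeltaM mul1g mulg1 act1g mulr1 mul1r act_gV.
congr qcls; apply: lval_inj; rewrite !lval_delta; congr (delta _ _).
by rewrite [RHS]mulrA uone_idem.
Qed.

Lemma unitd_incl a s :
  unitd s^-1%g * incl a = incl (act s^-1%g a) * unitd s^-1%g.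
Proof.
rewrite /incl /unitd -!qclsM !LdeltaM mul1g mulg1 mul1r act1g mulr1.
by [].
Qed.

Lemma unitdVM s t :
  unitd (s * t)^-1%g = unitd t^-1%g * unitd s^-1%g.
Proof. by rewrite unitdM invgM. Qed.

Lemma unitdV1 : unitd 1^-1%g = 1.
Proof. by rewrite invg1. Qed.

End Action.

(* A and S map to R by [j] and [u], and [v] plays the role of s |-> u (s^-1). *)
Section Invariants.
Variables (K : comPzRingType) (S : monoidType) (A R : pzAlgType K).
Variables (j : A -> R) (u v : S -> R).
Hypotheses (u1 : u 1%g = 1) (v1 : v 1%g = 1).
Hypotheses (uM : forall s t, u (s * t)%g = u s * u t).
Hypotheses (vM : forall s t, v (s * t)%g = v t * v s).
Hypothesis juv : forall a s, exists b, j a * u s = u s * j b /\ v s * j a = j b * v s.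
Variable M : lmodType (env R).

(* a x = x a for all a in A *)
Definition invariant (x : M) : Prop :=
  forall a : A, tens (j a) 1 *: x = tens 1 (j a) *: x.

Lemma invariant0 : invariant 0.
Proof. by move=> a; rewrite !scaler0. Qed.
Lemma invariantP (k : K) (x y : restrict M) :
  invariant x -> invariant y -> invariant (k *: x + y).
Proof.
move=> hx hy a; rewrite restrictE !scalerDr hy !scalerA -!scalC -!scalerA.
by rewrite hx.
Qed.
Definition inv_sub : submod (restrict M) :=
  @Submod K (restrict M) invariant invariant0 invariantP.

Lemma conj_invariant s (x : subT inv_sub) :
  inv_sub (tens (u s) (v s) *: (val x : M)).
Proof.
move=> a; have [b [ju vj]] := juv a s.
rewrite !scalerA !tensM mul1r mulr1 ju vj.
have := subTP x b; move: (val x) => {}x hx.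
have -> : tens (u s * j b) (v s) = tens (u s) (v s) * tens (j b) 1.
  by rewrite tensM mul1r.
have -> : tens (u s) (j b * v s) = tens (u s) (v s) * tens 1 (j b).
  by rewrite tensM mulr1.
by rewrite -!scalerA hx.
Qed.

(* s x = u(s) x v(s) *)
Definition conj_act (s : S) (x : subT inv_sub) : subT inv_sub :=
  subI (conj_invariant s x).

Lemma conj_act_linear s : linear (conj_act s).
Proof.
move=> k x y; apply: val_inj; rewrite /= [LHS]scalerDr !restrictE !scalerA.
by rewrite -scalC.
Qed.
Lemma conj_act1 x : conj_act 1%g x = x.
Proof. by apply: val_inj; rewrite /= u1 v1 tens1 scale1r. Qed.
Lemma conj_actM s t x : conj_act (s * t)%g x = conj_act s (conj_act t x).
Proof. by apply: val_inj; rewrite /= uM vM scalerA tensM. Qed.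
Definition conj_rep : monrep S (subT inv_sub) :=
  Monrep conj_act_linear conj_act1 conj_actM.
End Invariants.

(* K E(S), with s e = s e s^-1. *)
Section IdempotentModule.
Variables (K : comPzRingType) (S : inverseMonoidType).

Definition idemT : Type := {e : S | idempotent e}.
HB.instance Definition _ := Choice.on idemT.

Definition idem_conj (s : S) (e : idemT) : idemT :=
  Sub (s * val e * s^-1)%g (idempotent_conj s (valP e)).

Definition ke_act (s : S) (x : dsum idemT K^o) : dsum idemT K^o :=
  dlift (fun e k => delta (idem_conj s e) k) x.

Lemma ke_act_linear s : linear (ke_act s).
Proof. by apply: dliftZ => e k a b; rewrite deltaD deltaZ. Qed.

Lemma ke_actD s : {morph ke_act s : x y / x + y}.
Proof. by move=> x y; rewrite -[x]scale1r ke_act_linear !scale1r. Qed.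
Lemma ke_act_delta s e k : ke_act s (delta e k) = delta (idem_conj s e) k.
Proof. by rewrite /ke_act dlift_delta // => f; exact: deltaD. Qed.

Lemma ke_act1 x : ke_act 1%g x = x.
Proof.
elim/dsum_ind: x => [|x y hx hy|e k]; first exact: add_morph0 (ke_actD _).
  by rewrite ke_actD hx hy.
rewrite ke_act_delta; congr delta; apply: val_inj.
by rewrite /= invg1 mulg1 mul1g.
Qed.
Lemma ke_actM s t x : ke_act (s * t)%g x = ke_act s (ke_act t x).
Proof.
elim/dsum_ind: x => [|x y hx hy|e k].
- by rewrite !(add_morph0 (ke_actD _)).
- by rewrite !ke_actD hx hy.
rewrite !ke_act_delta; congr delta; apply: val_inj.
by rewrite /= invgM !mulgA.
Qed.

Definition ke_rep : monrep S (dsum idemT K^o) :=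
  Monrep ke_act_linear ke_act1 ke_actM.
Definition KE : lmodType (monalg K S) := repmod ke_rep.
End IdempotentModule.

Section Main.
Variable K : comPzRingType.

Definition separable (A : pzAlgType K) : Prop := projective (reg A).

Definition hochschild (R : pzAlgType K) (M : lmodType (env R)) (n : nat) :
  lmodType K := Ext n (reg R) M.

Definition inverse_cohomology (S : inverseMonoidType)
    (V : lmodType (monalg K S)) (n : nat) : lmodType K :=
  Ext n (KE K S) V.

Variables (S : inverseMonoidType) (A : pzAlgType K) (th : unital_action S A).

Lemma incl_unitd_comm a s : exists b,
  incl th a * unitd th s = unitd th s * incl th b /\
  unitd th s^-1%g * incl th a = incl th b * unitd th s^-1%g.
Proof.
by exists (act th s^-1%g a); rewrite incl_unitd unitd_incl.
Qed.

(* M^A with the KS-module structure s x = [1_s delta_s] x [1_(s^-1) delta_(s^-1)],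
   where a x = [a delta_1] x for a in A. *)
Definition invariants (M : lmodType (env (crossed th))) :
    lmodType (monalg K S) :=
  repmod (conj_rep (unitd1 th) (unitdV1 th) (fun s t => esym (unitdM th s t))
    (unitdVM th) incl_unitd_comm M).
End Main.

(* Main.v *)
(* Write R for the crossed product and e r = 1_e r for the action of E(S) on R.
   For a KS-module V the space N(V) = R (x)_{KE(S)} V is an R-bimodule, with
   a u_s (v (x) r) b = s v (x) a u_s r b where u_s = [1_s delta_s], and N is left
   adjoint to M |-> M^A.  Three facts make N carry a projective resolution of
   KE(S) to one of R, so that the adjunction identifies the two cochain complexes.
   - N is exact: K is a field and KE(S) is a union of finite-dimensional split
     semisimple algebras, hence every KE(S)-module is flat.
   - N preserves projectives: its right adjoint is exact, because A is projective
     over its enveloping algebra.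
   - N(KE(S)) = R, since KE(S) is free of rank one over itself. *)
From HB Require Import structures.
From mathcomp Require Import all_boot all_order ssralg.
From mathcomp Require Import boolp classical_sets.
Require Import Defs.

Set Implicit Arguments.
Unset Strict Implicit.
Unset Printing Implicit Defensive.

Import GRing.Theory.
Local Open Scope ring_scope.

(** [Ext] is defined through the canonical free resolution, and N need not carry the one of KE(S) to
    the one of R; hence the comparison theorem, by which any projective resolution computes [Ext].
    Flatness is used in an explicit form. On V (x)_K R an idempotent e yields the projection p_e = e
    (x) 1_e + (1 - e) (x) (1 - 1_e). These projections commute with one another and, up to e |-> s e
    s^-1, with the maps in use; the kernel of V (x)_K R -> N(V) consists of the elements killed by
    some finite product of them. Exactness of N thus reduces to exactness of tensoring over K, where
    linear contractions, available over a field, do the work. The left action of R on N(V) is well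
    defined because u_s e = (s e s^-1) u_s, and it respects s <= t because the tensor product is
    balanced. The unit of the adjunction is v |-> v (x) 1, which lands in the invariants since a (v
    (x) 1) = v (x) a = (v (x) 1) a. An element of M^A is the same as a bimodule map A -> M, read off
    at 1; this is how separability gives exactness of the right adjoint. *)

Section LinearMap.
Variables (R : pzRingType) (U V : lmodType R) (f : U -> V) (fL : linear f).
Definition linmap : {linear U -> V} :=
  HB.pack f (GRing.isLinear.Build R U V *:%R f fL).
Lemma linmapE x : linmap x = f x. Proof. by []. Qed.
End LinearMap.

Section Submodules.
Variables (R : pzRingType) (V : lmodType R) (P : submod V).

Lemma smemD x y : P x -> P y -> P (x + y).
Proof. by move=> hx hy; rewrite -[x]scale1r; apply: smemP. Qed.
Lemma smemZ a x : P x -> P (a *: x).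
Proof. by move=> hx; rewrite -[a *: x]addr0; apply: smemP (smem0 P). Qed.
Lemma smemN x : P x -> P (- x).
Proof. by move=> hx; rewrite -scaleN1r; apply: smemZ. Qed.
Lemma smemB x y : P x -> P y -> P (x - y).
Proof. by move=> hx hy; apply: smemD => //; apply: smemN. Qed.
End Submodules.

(** * Complements in vector spaces *)
Section VectorSpaces.
Variable K : fieldType.

(** Zorn's lemma gives a maximal subset closed under linear combinations and meeting P only in 0. A
    vector outside the sum of P and this set could be adjoined to it. *)
Lemma complement_exists (V : lmodType K) (P : submod V) :
  exists C : submod V, (forall x, P x -> C x -> x = 0) /\
    forall x, exists2 y, P y & C (x - y).
Proof.
pose good (C : set V) := (forall a x y, C x -> C y -> C (a *: x + y)) /\
  forall x, P x -> C x -> x = 0.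
have [F Fgood Ftot|C [[CP CD] Cmax]] := @Zorn_bigcup V good.
  split=> [a x y [C FC Cx] [D FD Dy]|x Px [C FC Cx]]; last first.
    by have [_] := Fgood _ FC; apply.
  have [CD|DC] := Ftot _ _ FC FD.
    by exists D => //; have [h _] := Fgood _ FD; apply: h => //; apply: CD.
  by exists C => //; have [h _] := Fgood _ FC; apply: h => //; apply: DC.
(* The enlargement of C by the line through x. The empty set satisfies [good], so 0 is adjoined by
   hand until [C0] is known. *)
pose C1 x : set V := fun z => exists k c, (C c \/ c = 0) /\ z = k *: x + c.
have maxE x : good (C1 x) -> C x.
  move=> C1good; apply: contrapT => Cx; apply: (Cmax (C1 x)) => //.
  split=> [z Cz|/(_ x)h]; first by exists 0, z; split; [left|rewrite scale0r add0r].
  by apply/Cx/h; exists 1, 0; split; [right|rewrite scale1r addr0].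
have C00 c : C c -> C 0 by move=> hc; rewrite -(addNr c) -scaleN1r; apply: CP.
have C1lin x a y z : C1 x y -> C1 x z -> C1 x (a *: y + z).
  move=> [k [c [hc ->]]] [l [d [hd ->]]]; exists (a * k + l), (a *: c + d).
  rewrite scalerDr scalerA addrACA -scalerDl; split=> //.
  case: hc hd => [hc|->] [hd|->]; rewrite ?scaler0 ?add0r; auto.
  by left; apply: CP (C00 _ hc).
have C0 : C 0.
  apply: maxE; split=> [|z Pz [k [c [[hc|->] zE]]]]; first exact: C1lin.
    by apply: CD => //; rewrite zE scaler0 add0r.
  by rewrite zE scaler0 addr0.
exists (Submod C0 CP); split=> // x.
have [Cx|Cx] := pselect (C x); first by exists 0; rewrite ?subr0 //; apply: smem0.
apply: contrapT => noy; apply/Cx/maxE; split=> [|z Pz [k [c [hc zE]]]].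
  exact: C1lin.
have {}hc : C c by case: hc => [|->].
have [k0|k0] := eqVneq k 0.
  by apply: CD => //; rewrite zE k0 scale0r add0r.
(* Rescaling z = k x + c gives the P-component of x, as x - k^-1 z = - k^-1 c lies in C. *)
case: noy; exists (k^-1 *: z); first exact: smemZ.
rewrite zE scalerDr scalerA mulVf // scale1r opprD addNKr -scaleNr.
by rewrite -[_ *: c]addr0; apply: CP.
Qed.

(** With C a complement of the kernel and D one of the image, p v is the unique x in C such that v -
    f x is in D; uniqueness makes p linear. *)
Lemma linear_pinv (U V : lmodType K) (f : {linear U -> V}) :
  exists p : {linear V -> U}, forall x, f (p (f x)) = f x.
Proof.
have imL : forall a u v, (exists x, f x = u) -> (exists x, f x = v) ->
    exists x, f x = a *: u + v.
  by move=> a _ _ [x <-] [y <-]; exists (a *: x + y); rewrite linearP.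
pose im := @Submod _ V (fun v => exists x, f x = v) (ex_intro _ 0 (linear0 f)) imL.
have [C [CK CD]] := complement_exists (ker_sub f).
have [D [DI DD]] := complement_exists im.
have pE v : exists x, C x /\ D (v - f x).
  have [_ [x <-] Dv] := DD v; have [y fy Cxy] := CD x.
  by exists (x - y); rewrite linearB (fy : f y = 0) subr0.
have [p pP] := choice pE.
have pL : linear p.
  move=> a u v; apply/eqP; rewrite -subr_eq0; apply/eqP.
  have [[Cu Du] [Cv Dv] [Cw Dw]] := And3 (pP u) (pP v) (pP (a *: u + v)).
  apply: CK; last by apply: smemB => //; apply: smemP.
  apply: DI; first by eexists.
  have := smemB (smemP a Du Dv) Dw; congr (D _).
  by rewrite [RHS]linearB linearP scalerBr addrACA -opprD opprB [LHS]addrC subrKA.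
exists (linmap pL) => x; rewrite linmapE; have [_ Dx] := pP (f x).
apply/esym/eqP; rewrite -subr_eq0; apply/eqP/DI => //.
by exists (x - p (f x)); rewrite linearB.
Qed.

(** Exactness at V in equational form, which survives tensoring. The maps come from generalised
    inverses p of f and q of g. *)
Lemma exact_contraction (U V W : lmodType K) (f : {linear U -> V})
    (g : {linear V -> W}) :
  (forall v, g v = 0 -> exists u, f u = v) ->
  exists (h : {linear V -> U}) (k : {linear W -> V}),
    forall v, v = f (h v) + k (g v).
Proof.
move=> exact_fg; have [p pE] := linear_pinv f; have [q qE] := linear_pinv g.
have hL : linear (fun v => p (v - q (g v))).
  move=> a u v; rewrite (linearP g) (linearP q).
  by rewrite opprD addrACA -scalerBr linearP.
exists (linmap hL), q => v; rewrite linmapE.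
have [|u uE] := exact_fg (v - q (g v)); first by rewrite linearB /= qE subrr.
by rewrite -uE pE uE subrK.
Qed.
End VectorSpaces.

(** * Independence of Ext of the resolution *)
Section CohomologyMap.
Variables (K : pzRingType) (U V W U' V' W' : lmodType K).
Variables (f : {linear U -> V}) (g : {linear V -> W}).
Variables (f' : {linear U' -> V'}) (g' : {linear V' -> W'}).
Variables (h : {linear V -> V'}) (hZ : forall v, g v = 0 -> g' (h v) = 0).
Hypothesis hB : forall u, exists u', h (f u) = f' u'.

Definition cocycle_map (z : subT (ker_sub g)) : subT (ker_sub g') :=
  subI (P := ker_sub g') (hZ (subTP z)).
Definition cohomology_map (q : cohomology f g) : cohomology f' g' :=
  cls (boundaries f' g') (cocycle_map (rep q)).

Lemma cohomology_mapE z :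
  cohomology_map (cls (boundaries f g) z) = cls (boundaries f' g') (cocycle_map z).
Proof.
apply/clsP; have [u hu] := rep_cls (boundaries f g) z.
have [u' hu'] := hB u; exists u'; rewrite -hu' hu; exact: linearB.
Qed.

Lemma cohomology_map_linear : linear cohomology_map.
Proof.
move=> a p q; rewrite -[p]repK -[q]repK -linearP !cohomology_mapE -linearP.
by congr (cls _ _); apply: val_inj; apply: linearP.
Qed.
End CohomologyMap.

(** Maps between the middle terms suffice, provided that they preserve cycles and boundaries and are
    mutually inverse on cycles up to boundaries. *)
Lemma cohomology_iso (K : pzRingType) (U V W U' V' W' : lmodType K)
    (f : {linear U -> V}) (g : {linear V -> W})
    (f' : {linear U' -> V'}) (g' : {linear V' -> W'})
    (h : {linear V -> V'}) (k : {linear V' -> V}) :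
    (forall v, g v = 0 -> g' (h v) = 0) ->
    (forall v, g' v = 0 -> g (k v) = 0) ->
    (forall u, exists u', h (f u) = f' u') ->
    (forall u, exists u', k (f' u) = f u') ->
    (forall v, g v = 0 -> exists u, f u = k (h v) - v) ->
    (forall v, g' v = 0 -> exists u, f' u = h (k v) - v) ->
  exists F : {linear cohomology f g -> cohomology f' g'}, bijective F.
Proof.
move=> hZ kZ hB kB kh hk.
exists (linmap (cohomology_map_linear hZ hB)).
exists (cohomology_map f kZ) => q; rewrite linmapE -[q]repK.
  by rewrite !cohomology_mapE //; apply/clsP; apply: kh (subTP (rep q)).
by rewrite !cohomology_mapE //; apply/clsP; apply: hk (subTP (rep q)).
Qed.

(** * Comparison of projective resolutions *)

Section Projective.
Variable R : pzRingType.

(** Projectivity lifts only through surjections, so d is corestricted to its image, which still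
    receives f. *)
Lemma projective_lift (P U V : lmodType R) (d : {linear U -> V})
    (f : {linear P -> V}) :
  projective P -> (forall x, exists u, d u = f x) ->
  exists h : {linear P -> U}, forall x, d (h x) = f x.
Proof.
move=> Pproj imf.
have imL a u v : (exists x, d x = u) -> (exists x, d x = v) ->
    exists x, d x = a *: u + v.
  by move=> [x <-] [y <-]; exists (a *: x + y); rewrite linearP.
pose im := @Submod _ V (fun v => exists x, d x = v) (ex_intro _ 0 (linear0 d)) imL.
pose d1 u : subT im := subI (P := im) (ex_intro _ u erefl).
have d1L : linear d1 by move=> a u v; apply: val_inj; apply: linearP.
pose f1 x : subT im := subI (P := im) (imf x).
have f1L : linear f1 by move=> a u v; apply: val_inj; apply: linearP.
have [|h hE] := Pproj _ _ (linmap d1L) (linmap f1L).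
  by move=> v; have [u du] := subTP v; exists u; apply: val_inj.
by exists h => x; have := congr1 val (hE x).
Qed.

Definition chain_map (M M' : lmodType R) (P : resolution M) (Q : resolution M')
    (h : forall n, {linear rmod P n -> rmod Q n}) :=
  forall n x, rdiff Q n (h n.+1 x) = h n (rdiff P n x).

Section Comparison.
Variables (M : lmodType R) (P Q : resolution M).

Lemma chain_map_exists : exists h : forall n, {linear rmod P n -> rmod Q n},
  (forall x, raug Q (h 0 x) = raug P x) /\ chain_map h.
Proof.
have rdiff_rdiff n x : rdiff P n (rdiff P n.+1 x) = 0.
  by apply/rdiff_exact; exists x.
(* Each lift depends on the preceding commuting square, so the recursion carries two consecutive
   components together with the square between them. *)
pose stage n := {hh : {linear rmod P n -> rmod Q n} *
  {linear rmod P n.+1 -> rmod Q n.+1} |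
  forall x, rdiff Q n (hh.2 x) = hh.1 (rdiff P n x)}.
have [h0 h0E] : exists h : {linear rmod P 0 -> rmod Q 0}, forall x, raug Q (h x) = raug P x.
  by apply: (projective_lift (d := raug Q) (f := raug P)) => [|x]; [exact: rmod_projective|exact: raug_surj].
have s0 : {s : stage 0 | (sval s).1 = h0}.
  apply: cid; have [|x|h1 h1E] := @projective_lift (rmod P 1) _ _ (rdiff Q 0) (h0 \o rdiff P 0).
  - exact: rmod_projective.
  - by apply/raug_exact; rewrite /= h0E; apply/raug_exact; eexists.
  by exists (exist _ (h0, h1) h1E).
have step n (s : stage n) : {s' : stage n.+1 | (sval s').1 = (sval s).2}.
  apply: cid; case: s => -[h h'] /= hE.
  have [|x|h'' h''E] := @projective_lift (rmod P n.+2) _ _ (rdiff Q n.+1) (h' \o rdiff P n.+1).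
  - exact: rmod_projective.
  - by apply/rdiff_exact; rewrite /= hE rdiff_rdiff linear0.
  by exists (exist _ (h', h'') h''E).
pose fix s n : stage n := if n is m.+1 then sval (step m (s m)) else sval s0.
exists (fun n => (sval (s n)).1); split=> [x|n x] /=.
  by rewrite (svalP s0) h0E.
by rewrite (svalP (step n (s n))); apply: (svalP (s n)).
Qed.

Lemma chain_homotopy0 (h k : forall n, {linear rmod P n -> rmod Q n}) :
    chain_map h -> chain_map k ->
    (forall x, raug Q (h 0 x) = raug Q (k 0 x)) ->
  exists s : {linear rmod P 0 -> rmod Q 1},
    forall x, h 0 x - k 0 x = rdiff Q 0 (s x).
Proof.
move=> hC kC haug.
have [|x|s sE] := @projective_lift (rmod P 0) _ _ (rdiff Q 0) (h 0 \- k 0).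
- exact: rmod_projective.
- by apply/raug_exact; rewrite /= linearB haug subrr.
by exists s => x; rewrite sE.
Qed.

(** Cohomology in one degree sees only two consecutive components of a homotopy, so no coherent
    family is built; in the induction the old t becomes the new s. *)
Lemma chain_homotopyS n (h k : forall n, {linear rmod P n -> rmod Q n}) :
    chain_map h -> chain_map k ->
    (forall x, raug Q (h 0 x) = raug Q (k 0 x)) ->
  exists (s : {linear rmod P n -> rmod Q n.+1})
         (t : {linear rmod P n.+1 -> rmod Q n.+2}),
    forall x, h n.+1 x - k n.+1 x = rdiff Q n.+1 (t x) + s (rdiff P n x).
Proof.
move=> hC kC haug.
have next m (s : {linear rmod P m -> rmod Q m.+1}) :
    (forall x, rdiff Q m (s (rdiff P m x)) = h m (rdiff P m x) - k m (rdiff P m x)) ->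
  exists t : {linear rmod P m.+1 -> rmod Q m.+2},
    forall x, h m.+1 x - k m.+1 x = rdiff Q m.+1 (t x) + s (rdiff P m x).
  move=> sE.
  have [|x|t tE] := @projective_lift (rmod P m.+1) _ _ (rdiff Q m.+1)
      ((h m.+1 \- k m.+1) \- (s \o rdiff P m)).
  - exact: rmod_projective.
  - by apply/rdiff_exact; rewrite /= !linearB /= hC kC sE subrr.
  by exists t => x; rewrite tE /= subrK.
elim: n => [|n [s [t tE]]].
  have [s sE] := chain_homotopy0 hC kC haug.
  by have [|t tE] := next 0 s; [move=> x; rewrite -sE|exists s, t].
have dd x : rdiff P n (rdiff P n.+1 x) = 0 by apply/rdiff_exact; exists x.
have [|t' t'E] := next n.+1 t; last by exists t, t'.
by move=> x; rewrite tE dd linear0 addr0.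
Qed.
End Comparison.
End Projective.

(** Comparison maps exist in both directions, and each round trip lifts the identity of M, hence is
    homotopic to the identity. A homotopy turns a cocycle into the coboundary by which its two
    images differ; in degree 0 they are equal. *)
Lemma Ext_resolution (K : comPzRingType) (R : pzAlgType K) (M N : lmodType R)
    (P Q : resolution M) n :
  exists F : {linear Ext_of P N n -> Ext_of Q N n}, bijective F.
Proof.
have [h [haug hC]] := chain_map_exists Q P.
have [k [kaug kC]] := chain_map_exists P Q.
have id_chain (T : resolution M) : chain_map (P := T) (Q := T) (fun n => idfun) by [].
have hkC : chain_map (fun n => h n \o k n) by move=> m x /=; rewrite hC kC.
have khC : chain_map (fun n => k n \o h n) by move=> m x /=; rewrite kC hC.
have pre0 (U V : lmodType R) (d : {linear U -> V}) (c : homT V N) :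
    precomp d c = 0 -> forall x, val c (d x) = 0.
  by move=> /(congr1 val) cd x; have := congr1 (fun f => f x) cd.
have valB U (c c' : homT U N) x : val (c - c') x = val c x - val c' x by [].
have vallin U (c : homT U N) : linear (val c : U -> N) by exact: (subTP (P := linear_sub U N) c).
have val_sub U (c : homT U N) x y : val c (x - y) = val c x - val c y.
  exact: (linearB (linmap (vallin U c))).
have val_add U (c : homT U N) x y : val c (x + y) = val c x + val c y.
  exact: (linearD (linmap (vallin U c))).
have preM (U V W : lmodType R) (f : {linear U -> V}) (g : {linear V -> W})
    (c : homT W N) : precomp f (precomp g c) = precomp (g \o f) c by exact: val_inj.
have cocycle_pre (T T' : resolution M) (f : forall n, {linear rmod T n -> rmod T' n}) :
    chain_map f -> forall m (c : homT (rmod T' m) N),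
  precomp (rdiff T' m) c = 0 -> precomp (rdiff T m) (precomp (f m) c) = 0.
  by move=> fC m c /pre0 cd; apply: val_inj; apply/funext => x /=; rewrite -fC cd.
have boundary_pre (T T' : resolution M) (f : forall n, {linear rmod T n -> rmod T' n}) :
    chain_map f -> forall m (c : homT (rmod T' m) N),
  exists c', precomp (f m.+1) (precomp (rdiff T' m) c) = precomp (rdiff T m) c'.
  move=> fC m c; exists (precomp (f m) c).
  by apply: val_inj; apply/funext => x /=; rewrite -fC.
have homotopic0 (T : resolution M) (f : forall n, {linear rmod T n -> rmod T n}) :
    chain_map f -> (forall x, raug T (f 0 x) = raug T x) ->
    forall c : homT (rmod T 0) N, precomp (rdiff T 0) c = 0 ->
  precomp (f 0) c - c = 0.
  move=> fC faug c /pre0 cd.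
  have [s sE] := chain_homotopy0 fC (id_chain T) faug.
  apply: val_inj; apply/funext => x; rewrite valB /=.
  by rewrite -[x in _ - val c x]/(idfun x) -val_sub sE cd.
have homotopicS (T : resolution M) (f : forall n, {linear rmod T n -> rmod T n}) :
    chain_map f -> (forall x, raug T (f 0 x) = raug T x) ->
    forall m (c : homT (rmod T m.+1) N), precomp (rdiff T m.+1) c = 0 ->
  exists c', precomp (rdiff T m) c' = precomp (f m.+1) c - c.
  move=> fC faug m c /pre0 cd.
  have [s [t tE]] := chain_homotopyS m fC (id_chain T) faug.
  exists (precomp s c).
  apply: val_inj; apply/funext => x; rewrite valB /=.
  by rewrite -[x in _ - val c x]/(idfun x) -val_sub tE val_add cd add0r.
have hkaug x : raug P (h 0 (k 0 x)) = raug P x by rewrite haug kaug.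
have khaug x : raug Q (k 0 (h 0 x)) = raug Q x by rewrite kaug haug.
case: n => [|n]; apply: (@cohomology_iso _ _ _ _ _ _ _ _ _ _ _
    (precomp (h _)) (precomp (k _))).
- exact: cocycle_pre.
- exact: cocycle_pre.
- by move=> u; exists 0; rewrite !linear0.
- by move=> u; exists 0; rewrite !linear0.
- by move=> c /(homotopic0 _ _ hkC hkaug) cE; exists 0; rewrite /= preM cE.
- by move=> c /(homotopic0 _ _ khC khaug) cE; exists 0; rewrite /= preM cE.
- exact: cocycle_pre.
- exact: cocycle_pre.
- exact: boundary_pre.
- exact: boundary_pre.
- by move=> c; rewrite /= preM; apply: homotopicS hkC hkaug _ _.
- by move=> c; rewrite /= preM; apply: homotopicS khC khaug _ _.
Qed.

(** * Tensor products over K *)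
Section Tensor.
Variables (K : comPzRingType) (V W : lmodType K).

Definition bilinear (U : lmodType K) (phi : V -> W -> U) : Prop :=
  (forall w, linear (phi^~ w)) /\ (forall v, linear (phi v)).

Definition prelift (U : lmodType K) (phi : V -> W -> U)
  (x : dsum (V * W)%type K^o) : U :=
  dlift (fun p (k : K^o) => (k : K) *: phi p.1 p.2) x.

Lemma prelift_linear (U : lmodType K) (phi : V -> W -> U) : linear (prelift phi).
Proof. by apply: dliftZ => p a k l; rewrite scalerDl scalerA. Qed.

Lemma prelift_delta (U : lmodType K) (phi : V -> W -> U) v w k :
  prelift phi (delta (v, w) k) = (k : K) *: phi v w.
Proof. by rewrite /prelift dlift_delta // => p a b; rewrite scalerDl. Qed.

Lemma preliftB (U : lmodType K) (phi : V -> W -> U) x y :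
  prelift phi (x - y) = prelift phi x - prelift phi y.
Proof. exact: (linearB (linmap (prelift_linear phi))). Qed.

(* Quantifying over all bilinear maps makes the universal property immediate. *)
Definition bilinear_null (x : dsum (V * W)%type K^o) : Prop :=
  forall (U : lmodType K) (phi : V -> W -> U), bilinear phi -> prelift phi x = 0.

Lemma bilinear_null0 : bilinear_null 0.
Proof. by move=> U phi _; exact: (linear0 (linmap (prelift_linear phi))). Qed.
Lemma bilinear_nullP k x y :
  bilinear_null x -> bilinear_null y -> bilinear_null (k *: x + y).
Proof.
move=> hx hy U phi bphi; rewrite prelift_linear hx // hy //.
by rewrite scaler0 addr0.
Qed.

Let pretensor : lmodType K := quoT (Submod bilinear_null0 bilinear_nullP).
Let preten (v : V) (w : W) : pretensor := cls _ (delta (v, w) (1 : K^o)).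

Let prelift_cls (U : lmodType K) (phi : V -> W -> U) x :
  bilinear phi -> prelift phi (rep (cls _ x : pretensor)) = prelift phi x.
Proof.
move=> bphi; apply/eqP; rewrite -subr_eq0 -preliftB; apply/eqP.
exact: (rep_cls (Submod bilinear_null0 bilinear_nullP)).
Qed.

Let nullE x y : (forall (U : lmodType K) (phi : V -> W -> U), bilinear phi ->
  prelift phi x = prelift phi y) -> cls _ x = cls _ y :> pretensor.
Proof.
by move=> h; apply/clsP => U phi bphi; rewrite preliftB (h _ _ bphi) subrr.
Qed.

Lemma tensor_exists : {T : lmodType K & {t : V -> W -> T | [/\ bilinear t,
  forall Q : T -> Prop, Q 0 -> (forall x y, Q x -> Q y -> Q (x + y)) ->
    (forall v w, Q (t v w)) -> forall x, Q x &
  forall (U : lmodType K) (phi : V -> W -> U), bilinear phi ->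
    exists f : {linear T -> U}, forall v w, f (t v w) = phi v w]}}.
Proof.
have bil : bilinear preten.
  split=> [w|v] k x y; rewrite /preten -linearP; apply: nullE => U phi [phil phir];
    by rewrite prelift_linear !prelift_delta !scale1r ?phil ?phir.
exists pretensor, preten; split=> // [Q Q0 QD Qt x|U phi bphi].
  rewrite -[x]repK; elim/dsum_ind: (rep x) => [|f g|[v w] k].
  - by rewrite linear0.
  - by rewrite linearD; apply: QD.
  suff -> : cls _ (delta (v, w) k) = preten ((k : K) *: v) w by exact: Qt.
  have -> : preten ((k : K) *: v) w = (k : K) *: preten v w.
    exact: (linearZ_LR (linmap (bil.1 w))).
  by rewrite /preten -linearZ -deltaZ /GRing.scale /= mulr1.
have fL : linear (fun x : pretensor => prelift phi (rep x)).
  move=> k x y; rewrite -[x]repK -[y]repK -linearP !prelift_cls //.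
  exact: prelift_linear.
exists (linmap fL) => v w.
by rewrite linmapE prelift_cls // prelift_delta scale1r.
Qed.

(* The construction is hidden behind an opaque existence statement, so that
   unification never unfolds it. *)
Definition tensor : lmodType K := projT1 tensor_exists.
Definition ten : V -> W -> tensor := projT1 (projT2 tensor_exists).

Lemma ten_bilinear : bilinear ten.
Proof. by have [] := projT2 (projT2 tensor_exists). Qed.

Lemma tensor_ind (Q : tensor -> Prop) :
  Q 0 -> (forall x y, Q x -> Q y -> Q (x + y)) -> (forall v w, Q (ten v w)) ->
  forall x, Q x.
Proof. by have [_ + _] := projT2 (projT2 tensor_exists); apply. Qed.

Lemma tlift_exists (U : lmodType K) (phi : V -> W -> U) : bilinear phi ->
  exists f : {linear tensor -> U}, forall v w, f (ten v w) = phi v w.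
Proof. by have [_ _] := projT2 (projT2 tensor_exists); apply. Qed.

Definition tlift (U : lmodType K) (phi : V -> W -> U) (bphi : bilinear phi) :
  {linear tensor -> U} := projT1 (cid (tlift_exists bphi)).
Lemma tliftE (U : lmodType K) (phi : V -> W -> U) (bphi : bilinear phi) v w :
  tlift bphi (ten v w) = phi v w.
Proof. exact: (projT2 (cid (tlift_exists bphi))). Qed.

Lemma tenBl v v' w : ten (v - v') w = ten v w - ten v' w.
Proof. exact: (linearB (linmap (ten_bilinear.1 w))). Qed.
Lemma tenBr v w w' : ten v (w - w') = ten v w - ten v w'.
Proof. exact: (linearB (linmap (ten_bilinear.2 v))). Qed.
Lemma tenDl v v' w : ten (v + v') w = ten v w + ten v' w.
Proof. exact: (linearD (linmap (ten_bilinear.1 w))). Qed.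
Lemma tenDr v w w' : ten v (w + w') = ten v w + ten v w'.
Proof. exact: (linearD (linmap (ten_bilinear.2 v))). Qed.
Lemma tenZl k v w : ten (k *: v) w = k *: ten v w.
Proof. exact: (linearZ_LR (linmap (ten_bilinear.1 w))). Qed.
Lemma tenZr k v w : ten v (k *: w) = k *: ten v w.
Proof. exact: (linearZ_LR (linmap (ten_bilinear.2 v))). Qed.
Lemma ten0l w : ten 0 w = 0.
Proof. exact: (linear0 (linmap (ten_bilinear.1 w))). Qed.

Lemma ten0r v : ten v 0 = 0.
Proof. exact: (linear0 (linmap (ten_bilinear.2 v))). Qed.

Lemma tensor_ext (U : zmodType) (f g : tensor -> U) :
  {morph f : x y / x + y} -> {morph g : x y / x + y} ->
  (forall v w, f (ten v w) = g (ten v w)) -> f =1 g.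
Proof.
move=> fD gD fg; elim/tensor_ind => [|x y fx fy|//].
  by rewrite !add_morph0.
by rewrite fD gD fx fy.
Qed.
End Tensor.

Section TensorMap.
Variables (K : comPzRingType).

Lemma tenmap_bilinear (V W V' W' : lmodType K) (f : {linear V -> V'})
    (g : {linear W -> W'}) : bilinear (fun v w => ten (f v) (g w)).
Proof.
have [tl tr] := ten_bilinear V' W'.
by split=> [w|v] k x y; rewrite linearP ?tl ?tr.
Qed.

Definition tenmap (V W V' W' : lmodType K) (f : {linear V -> V'})
    (g : {linear W -> W'}) : {linear tensor V W -> tensor V' W'} :=
  tlift (tenmap_bilinear f g).

Lemma tenmapE (V W V' W' : lmodType K) (f : {linear V -> V'})
    (g : {linear W -> W'}) v w : tenmap f g (ten v w) = ten (f v) (g w).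
Proof. exact: (tliftE (tenmap_bilinear f g)). Qed.

Lemma tenmap_ext (V W U : lmodType K) (f g : {linear tensor V W -> U}) :
  (forall v w, f (ten v w) = g (ten v w)) -> f =1 g.
Proof. by move=> fg; apply: tensor_ext => //; apply: linearD. Qed.
End TensorMap.

(** A contraction of U -> V -> W tensored with X is a contraction of the tensored sequence, and
    [tenmap h] supplies the preimage. *)
Lemma tensor_exact (K : fieldType) (U V W X : lmodType K)
    (f : {linear U -> V}) (g : {linear V -> W}) :
  (forall v, g v = 0 -> exists u, f u = v) ->
  forall x, tenmap g (idfun : {linear X -> X}) x = 0 ->
  exists y, tenmap f (idfun : {linear X -> X}) y = x.
Proof.
move=> /exact_contraction[h [k hk]] x gx; pose iX : {linear X -> X} := idfun.
exists (tenmap h iX x).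
suff E : tenmap f iX (tenmap h iX x) + tenmap k iX (tenmap g iX x) = x.
  by rewrite -[RHS]E gx linear0 addr0.
apply: (tenmap_ext (f := (tenmap f iX \o tenmap h iX) \+ (tenmap k iX \o tenmap g iX))
  (g := idfun)) => v w.
by rewrite /= !tenmapE /= [in RHS](hk v) tenDl.
Qed.

(** * Balancing projections for pairs of idempotents *)

Section Cut.
Variable K : comPzRingType.

Section Def.
Variables (V W : lmodType K) (f : {linear V -> V}) (g : {linear W -> W}).

(* For idempotent f and g, the projection of V (x) W onto the largest quotient
   on which f (x) 1 and 1 (x) g agree. *)
Definition cut (x : tensor V W) : tensor V W :=
  tenmap f g x + tenmap (idfun \- f) (idfun \- g) x.

Lemma cut_linear : linear cut.
Proof. by move=> k x y; rewrite /cut !linearP scalerDr addrACA.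
Qed.
HB.instance Definition _ :=
  GRing.isLinear.Build K (tensor V W) (tensor V W) *:%R cut cut_linear.

Lemma cutE v w : cut (ten v w) = ten (f v) (g w) + ten (v - f v) (w - g w).
Proof. by rewrite /cut !tenmapE. Qed.

Lemma cutD : {morph cut : x y / x + y}.
Proof. exact: linearD. Qed.

(** [cut] drops the mixed terms f v (x) (w - g w) and (v - f v) (x) g w; a balanced psi kills both,
    because f f = f. *)
Lemma cut_balanced (U : zmodType) (psi : tensor V W -> U) :
    {morph psi : x y / x + y} -> (forall v, f (f v) = f v) ->
    (forall v w, psi (ten (f v) w) = psi (ten v (g w))) ->
  forall x, psi (cut x) = psi x.
Proof.
move=> psiD ff psi_bal; apply: tensor_ext => // [x y|v w].
  by rewrite cutD psiD.
have psiB x y : psi (x - y) = psi x - psi y.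
  by apply/eqP; rewrite eq_sym subr_eq -psiD subrK.
rewrite cutE psiD tenBl !tenBr !psiB -!psi_bal ff subrr subr0.
by rewrite addrCA subrr addr0.
Qed.
End Def.

Lemma tenmap_cut (V W V' W' : lmodType K) (f : {linear V -> V})
    (g : {linear W -> W}) (f' : {linear V' -> V'}) (g' : {linear W' -> W'})
    (h : {linear V -> V'}) (k : {linear W -> W'}) :
    (forall v, h (f v) = f' (h v)) -> (forall w, k (g w) = g' (k w)) ->
  forall x, tenmap h k (cut f g x) = cut f' g' (tenmap h k x).
Proof.
move=> hf kg; apply: (tenmap_ext (f := tenmap h k \o cut f g)
  (g := cut f' g' \o tenmap h k)) => v w /=.
by rewrite tenmapE !cutE linearD !tenmapE (linearB h) (linearB k) hf kg.
Qed.

Lemma cut_comm (V W : lmodType K) (f f' : {linear V -> V}) (g g' : {linear W -> W}) :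
    (forall v, f (f' v) = f' (f v)) -> (forall w, g (g' w) = g' (g w)) ->
  forall x, cut f g (cut f' g' x) = cut f' g' (cut f g x).
Proof.
move=> ff gg x; rewrite {1}/cut.
rewrite !(@tenmap_cut _ _ _ _ f' g' f' g') -?cutD // => v /=.
  by rewrite (linearB f') ff.
by rewrite (linearB g') gg.
Qed.

(** [cut f g] is itself balanced, as it sends both f v (x) w and v (x) g w to f v (x) g w. So
    [cut_balanced] applies to it. *)
Lemma cut_idem (V W : lmodType K) (f : {linear V -> V}) (g : {linear W -> W}) :
    (forall v, f (f v) = f v) -> (forall w, g (g w) = g w) ->
  forall x, cut f g (cut f g x) = cut f g x.
Proof.
move=> ff gg; apply: cut_balanced => // [x y|v w]; first exact: cutD.
by rewrite !cutE ff gg !subrr ten0l ten0r.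
Qed.
End Cut.

(** * Bimodules as modules over the enveloping algebra *)
Section Enveloping.
Variables (K : comPzRingType) (R : pzAlgType K).

Lemma tensPl (k : K) (a a' b : R) :
  tens (scal k * a + a') b = scal k * tens a b + tens a' b.
Proof.
rewrite /tens -qclsM -raddfD; apply/qclsP. apply: generated_gen.
exact: RelLeft.
Qed.
Lemma tensPr (k : K) (a b b' : R) :
  tens a (scal k * b + b') = scal k * tens a b + tens a b'.
Proof.
rewrite /tens -qclsM -raddfD; apply/qclsP. apply: generated_gen.
exact: RelRight.
Qed.
Lemma tensDl (a a' b : R) : tens (a + a') b = tens a b + tens a' b.
Proof. by have := tensPl 1 a a' b; rewrite scal1 !mul1r. Qed.
Lemma tens0l (b : R) : tens 0 b = 0.
Proof. by apply: (addrI (tens 0 b)); rewrite -tensDl !addr0. Qed.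
Lemma tensDr (a b b' : R) : tens a (b + b') = tens a b + tens a b'.
Proof. by have := tensPr 1 a b b'; rewrite scal1 !mul1r. Qed.
Lemma tens_scal (k : K) (a b : R) : tens (scal k * a) b = scal k * tens a b.
Proof. by have := tensPl k a 0 b; rewrite tens0l !addr0. Qed.
Lemma tens_scalr (k : K) (a b : R) : tens a (scal k * b) = scal k * tens a b.
Proof.
have tens0r : tens a (0 : R) = 0.
  by apply: (addrI (tens a 0)); rewrite -tensDr !addr0.
by have := tensPr k a b 0; rewrite tens0r !addr0.
Qed.
Lemma scal_tens (k : K) : scal k = tens (scal k) 1 :> env R.
Proof. by rewrite -[scal k in RHS]mulr1 tens_scal tens1 mulr1. Qed.

Lemma env_ind (Q : env R -> Prop) :
  Q 0 -> (forall x y, Q x -> Q y -> Q (x + y)) -> (forall a b, Q (tens a b)) ->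
  forall x, Q x.
Proof.
move=> Q0 QD Qt x; rewrite -[x]qrepK; elim/dsum_ind: (qrep x) => [|f g|[a b] k].
- by rewrite raddf0.
- by rewrite raddfD; apply: QD.
suff -> : qcls (@bilinear_relator K R) (delta ((a, b) : envmon R) k)
    = tens (scal (k : K) * a) b by exact: Qt.
rewrite tens_scal /tens -qclsM; congr qcls.
by rewrite [RHS]mmul_delta mul1g mulr1.
Qed.

Lemma env_linear (M N : lmodType (env R)) (h : M -> N) :
  {morph h : x y / x + y} ->
  (forall a b x, h (tens a b *: x) = tens a b *: h x) -> linear h.
Proof.
move=> hD hZ a u v; rewrite hD; congr (_ + _); elim/env_ind: a => [|a b ha hb|//].
  by rewrite !scale0r add_morph0.
by rewrite !scalerDl hD ha hb.
Qed.

Section Bimodule.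
Variables (Y : lmodType K) (lam rho : R -> Y -> Y).
Hypotheses (lam_linear : forall a, linear (lam a))
  (rho_linear : forall a, linear (rho a)).
Hypothesis lam_scal :
  forall k a a' y, lam (scal k * a + a') y = k *: lam a y + lam a' y.
Hypothesis rho_scal :
  forall k a a' y, rho (scal k * a + a') y = k *: rho a y + rho a' y.
Hypotheses (lam1 : forall y, lam 1 y = y) (rho1 : forall y, rho 1 y = y).
Hypothesis lamM : forall a b y, lam (a * b) y = lam a (lam b y).
Hypothesis rhoM : forall a b y, rho (a * b) y = rho b (rho a y).
Hypothesis lam_rho : forall a b y, lam a (rho b y) = rho b (lam a y).

Lemma bimod_linear (p : envmon R) : linear (fun y : Y => lam p.1 (rho p.2 y)).
Proof. by move=> k x y; rewrite rho_linear lam_linear. Qed.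
Lemma bimod_act1 y : lam (1%g : envmon R).1 (rho (1%g : envmon R).2 y) = y.
Proof. by rewrite rho1 lam1. Qed.
Lemma bimod_actM (p q : envmon R) y : lam (p * q)%g.1 (rho (p * q)%g.2 y)
  = lam p.1 (rho p.2 (lam q.1 (rho q.2 y))).
Proof. by rewrite /= lamM rhoM !lam_rho. Qed.
Definition bimod_rep : monrep (envmon R) Y :=
  Monrep bimod_linear bimod_act1 bimod_actM.

Lemma bimod_relator g (y : repmod bimod_rep) :
  bilinear_relator g -> g *: y = 0.
Proof.
have E a b : mdelta K ((a, b) : envmon R) *: y = lam a (rho b y).
  exact: rep_mdelta.
case=> [k a a' b|k a b b']; apply/eqP; rewrite scalerBl scalerDl subr_eq0;
  apply/eqP; rewrite -scalerA !E rep_scal; first exact: lam_scal.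
by rewrite rho_scal lam_linear.
Qed.

Definition bimod : lmodType (env R) := quomod bimod_relator.

Lemma bimod_tens a b (y : bimod) : tens a b *: y = lam a (rho b y).
Proof. by rewrite [LHS]quomod_scaleE [LHS]rep_mdelta. Qed.
Lemma bimod_scal k (y : bimod) : (scal k : env R) *: y = k *: (y : Y).
Proof. by rewrite [LHS]quomod_scaleE [LHS]rep_scal. Qed.
End Bimodule.
End Enveloping.

(** * Generators of the crossed product and its left modules *)

Section Crossed.
Variables (K : comPzRingType) (S : inverseMonoidType) (A : pzAlgType K).
Variable th : unital_action S A.
Local Notation R := (crossed th).
Local Notation "1_ s" := (uone th s) (at level 8, s at level 2, format "1_ s").

Lemma incl_unitdE a s : incl th a * unitd th s = qcls _ (Ldelta th s a).
Proof. by rewrite /incl /unitd -qclsM LdeltaM mul1g act1g mulr1. Qed.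

Lemma inclD : {morph incl th : a b / a + b}.
Proof. by move=> a b; rewrite /incl LdeltaD raddfD. Qed.
Lemma inclM : {morph incl th : a b / a * b}.
Proof. by move=> a b; rewrite /incl -qclsM LdeltaM mulg1 act1g. Qed.
Lemma incl1 : incl th 1 = 1. Proof. by []. Qed.
Lemma incl_scal k : incl th (scal k) = scal k. Proof. by []. Qed.

Lemma unitd_incl_act a s : unitd th s * incl th a = incl th (act th s a) * unitd th s.
Proof. by have := unitd_incl th a s^-1%g; rewrite invgK. Qed.

(** This is the order relator for e <= 1 with coefficient 1_e. *)
Lemma unitd_idem e : idempotent e -> unitd th e = incl th 1_e.
Proof.
move=> ee; apply/qclsP; apply: generated_gen.
exists e, 1%g, 1; split; first by exists e; rewrite ?mulg1.
have lvalB f g : lval (f - g) = lval f - lval g :> dsum S A^o by [].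
by rewrite lvalB !lval_delta !mulr1 uone1 mul1r.
Qed.

Lemma crossed_ind (Q : R -> Prop) :
  Q 0 -> (forall x y, Q x -> Q y -> Q (x + y)) ->
  (forall a s, Q (incl th a * unitd th s)) -> forall x, Q x.
Proof.
move=> Q0 QD Qg x; rewrite -[x]qrepK; elim/L_ind: (qrep x) => [|f g|s a].
- by rewrite raddf0.
- by rewrite raddfD; apply: QD.
by rewrite -incl_unitdE.
Qed.

Section LeftAction.
Variables (Y : zmodType) (act_gen : S -> A -> Y -> Y).
Hypotheses (genDl : forall s y, {morph act_gen s ^~ y : a b / a + b})
  (genDr : forall s a, {morph act_gen s a : y z / y + z})
  (gen_uone : forall s a y, act_gen s (1_s * a) y = act_gen s a y)
  (gen_le : forall s t a y, nle s t -> act_gen s (1_s * a) y = act_gen t (1_s * a) y)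
  (genM : forall s t a b y,
     act_gen s a (act_gen t b y) = act_gen (s * t)%g (a * act th s b) y)
  (gen1 : forall y, act_gen 1%g 1 y = y).

Let actL (f : Lalg th) (y : Y) : Y := dlift (fun s (a : A^o) => act_gen s a y) (lval f).

Let actLDl y : {morph actL ^~ y : f g / f + g}.
Proof. by move=> f g; rewrite /actL lvalD dliftD // => s; apply: genDl. Qed.
Let actL_delta s a y : actL (Ldelta th s a) y = act_gen s a y.
Proof. by rewrite /actL lval_delta dlift_delta ?gen_uone // => t; apply: genDl. Qed.
Let actLDr f : {morph actL f : y z / y + z}.
Proof.
move=> y z; rewrite /actL /dlift -big_split; apply: eq_bigr => s _.
exact: genDr.
Qed.
Let actLM f g y : actL (f * g) y = actL f (actL g y).
Proof.
have actL0l z : actL 0 z = 0 by exact: (add_morph0 (actLDl z)).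
have actL0r h : actL h 0 = 0 by exact: (add_morph0 (actLDr h)).
elim/L_ind: f => [|f f' Hf Hf'|s a]; first by rewrite mul0r !actL0l.
  by rewrite mulrDl !actLDl Hf Hf'.
elim/L_ind: g => [|g g' Hg Hg'|t b]; first by rewrite mulr0 actL0l actL0r.
  by rewrite mulrDr !actLDl actLDr Hg Hg'.
by rewrite LdeltaM !actL_delta genM.
Qed.
(** The elements annihilating Y form a two-sided ideal, and [gen_le] puts the order relators into
    it. *)
Let actL_null f y : generated (order_relator (th := th)) f -> actL f y = 0.
Proof.
have actL0l z : actL 0 z = 0 by exact: (add_morph0 (actLDl z)).
have actL0r h : actL h 0 = 0 by exact: (add_morph0 (actLDr h)).
move=> /(_ (fun f => forall y, actL f y = 0)); apply=> [|{}f [s [t [a [st fE]]]] {}y].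
  split=> [//|f1 f2 h1 h2 z|f1 f2 h z|f1 f2 h z].
  - by rewrite actLDl h1 h2 addr0.
  - by rewrite actLM h.
  - by rewrite actLM h.
have dD u : {morph (fun a : A^o => act_gen u a y) : a b / a + b} by apply: genDl.
apply: (addIr (act_gen t (1_s * a) y)); rewrite add0r -{2}(gen_le _ _ st) /actL fE.
have := dliftD dD (delta s (1_s * a) - delta t (1_s * a)) (delta t (1_s * a)).
by rewrite subrK !dlift_delta // => <-.
Qed.

(** The action of the crossed product in which the class of (1_s a) delta_s acts as
    [act_gen s a]. *)
Definition left_act (p : R) (y : Y) : Y := actL (qrep p) y.

Lemma left_act_cls f y : left_act (qcls _ f) y = actL f y.
Proof.
apply/eqP; rewrite -subr_eq0; apply/eqP.
have /(actL_null y) : generated (order_relator (th := th)) (qrep (qcls (@order_relator K S A th) f) - f).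
  by apply/qclsP; rewrite qrepK.
move=> h; have := actLDl y (qrep (qcls (@order_relator K S A th) f) - f) f.
by rewrite h subrK add0r /left_act => ->; rewrite subrr.
Qed.

Lemma left_act_gen a s y : left_act (incl th a * unitd th s) y = act_gen s a y.
Proof. by rewrite incl_unitdE left_act_cls actL_delta. Qed.
Lemma left_actDl y : {morph left_act ^~ y : p q / p + q}.
Proof. by move=> p q; rewrite -[p]qrepK -[q]qrepK -raddfD !left_act_cls actLDl. Qed.
Lemma left_actM p q y : left_act (p * q) y = left_act p (left_act q y).
Proof. by rewrite -[p]qrepK -[q]qrepK -qclsM !left_act_cls actLM. Qed.
Lemma left_act1 y : left_act 1 y = y.
Proof. by have := left_act_gen 1 1%g y; rewrite mul1r unitd1 gen1. Qed.
End LeftAction.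
End Crossed.

(** * The balanced tensor product as a bimodule *)
Section Multiplications.
Variables (K : comPzRingType) (R : pzAlgType K).
Local Notation RK := (restrict (R^o : lmodType R)).

Definition lmulr (a : R) (x : RK) : RK := a * (x : R).
Definition rmulr (a : R) (x : RK) : RK := (x : R) * a.
Lemma lmulr_linear a : linear (lmulr a).
Proof.
move=> k x y; rewrite !restrictE /lmulr /GRing.scale /= mulrDr.
by rewrite mulrA -scalC -mulrA.
Qed.
Lemma rmulr_linear a : linear (rmulr a).
Proof.
by move=> k x y; rewrite !restrictE /rmulr /GRing.scale /= mulrDl mulrA.
Qed.
HB.instance Definition _ a :=
  GRing.isLinear.Build K RK RK *:%R (lmulr a) (lmulr_linear a).
HB.instance Definition _ a :=
  GRing.isLinear.Build K RK RK *:%R (rmulr a) (rmulr_linear a).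

Variables (S : monoidType) (V : lmodType (monalg K S)).
Definition sact (s : S) (v : restrict V) : restrict V := mdelta K s *: (v : V).
Lemma sact_linear s : linear (sact s).
Proof.
by move=> k v w; rewrite !restrictE /sact scalerDr !scalerA scalC.
Qed.
HB.instance Definition _ s :=
  GRing.isLinear.Build K (restrict V) (restrict V) *:%R (sact s) (sact_linear s).
Lemma sactM s t v : sact (s * t)%g v = sact s (sact t v).
Proof. by rewrite /sact scalerA [mdelta K s * _]mmul_delta mulr1. Qed.
Lemma sact1 v : sact 1%g v = v.
Proof. exact: scale1r. Qed.
End Multiplications.

Section BalancedTensor.
Variables (K : comPzRingType) (S : inverseMonoidType) (A : pzAlgType K).
Variable th : unital_action S A.
Local Notation R := (crossed th).
Local Notation RK := (restrict (R^o : lmodType R)).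
Local Notation "1_ s" := (uone th s) (at level 8, s at level 2, format "1_ s").
Local Notation E := (idemT S).

Lemma unitd_mulV s : unitd th s * unitd th s^-1%g = incl th 1_s.
Proof. by rewrite unitdM unitd_idem ?idempotent_gV // uone_gV. Qed.

Section Bal.
Variable V : lmodType (monalg K S).
Local Notation T := (tensor (restrict V) RK).

Definition bal (e : E) : T -> T := cut (sact (val e)) (lmulr (unitd th (val e))).
HB.instance Definition _ e := GRing.Linear.on (bal e).
Definition bals (l : seq E) (x : T) : T := foldr bal x l.

Lemma sact_idem (e : E) (v : restrict V) : sact (val e) (sact (val e) v) = sact (val e) v.
Proof. by rewrite -sactM (eqP (valP e)). Qed.
Lemma unitd_mul_idem (e : E) (x : RK) :
  lmulr (unitd th (val e)) (lmulr (unitd th (val e)) x) = lmulr (unitd th (val e)) x.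
Proof. by rewrite /lmulr mulrA unitdM (eqP (valP e)). Qed.

Lemma bal_comm e e' x : bal e (bal e' x) = bal e' (bal e x).
Proof.
have ee' : (val e * val e' = val e' * val e)%g by exact: idempotent_comm (valP e) (valP e').
apply: cut_comm => [v|w]; first by rewrite /= -!sactM ee'.
by rewrite /= /lmulr !mulrA !unitdM ee'.
Qed.
Lemma bal_idem e x : bal e (bal e x) = bal e x.
Proof. by apply: cut_idem; [exact: sact_idem|exact: unitd_mul_idem]. Qed.

Lemma bals_linear l : linear (bals l).
Proof.
elim: l => [|e l IH] k x y //=; rewrite IH.
exact: linearP.
Qed.
HB.instance Definition _ l := GRing.isLinear.Build K T T *:%R (bals l) (bals_linear l).
Lemma bals_bal l e x : bals l (bal e x) = bal e (bals l x).
Proof. by elim: l => //= e' l ->; rewrite bal_comm. Qed.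
Lemma balsC l l' x : bals l (bals l' x) = bals l' (bals l x).
Proof. by elim: l => //= e l ->; rewrite bals_bal. Qed.
Lemma bals_idem l x : bals l (bals l x) = bals l x.
Proof. by elim: l => //= e l IH; rewrite bals_bal IH bal_idem. Qed.
Lemma bals_cat l l' x : bals (l ++ l') x = bals l (bals l' x).
Proof. exact: foldr_cat. Qed.

(* The kernel of V (x)_K R -> V (x)_{KE(S)} R: finitely many commuting idempotents
   already witness that an element vanishes there. *)
Definition unbalanced (x : T) : Prop := exists l, bals l x = 0.
Lemma unbalanced0 : unbalanced 0.
Proof. by exists [::]. Qed.
Lemma unbalancedP k x y : unbalanced x -> unbalanced y -> unbalanced (k *: x + y).
Proof.
move=> [l hx] [l' hy]; exists (l ++ l').
by rewrite bals_cat !bals_linear hy balsC hx !linear0 addr0.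
Qed.
Definition unbalanced_sub : submod T := Submod unbalanced0 unbalancedP.

Lemma unbalanced_gen (e : E) v r :
  unbalanced (ten (sact (val e) v) r - ten v (lmulr (unitd th (val e)) r)).
Proof.
exists [:: e]; rewrite /= linearB /= /bal !cutE /= sact_idem unitd_mul_idem.
by rewrite !subrr ten0l ten0r subrr.
Qed.
(** A balanced map does not change under any of the projections, so it vanishes on whatever a
    product of them kills. *)
Lemma unbalanced_null (U : zmodType) (psi : T -> U) :
    {morph psi : x y / x + y} ->
    (forall (e : E) v r,
       psi (ten (sact (val e) v) r) = psi (ten v (lmulr (unitd th (val e)) r))) ->
  forall x, unbalanced x -> psi x = 0.
Proof.
move=> psiD psi_bal x [l lx]; suff <- : psi (bals l x) = psi x.
  by rewrite lx add_morph0.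
elim: l {lx} => //= e l <-.
by apply: cut_balanced => // v; [exact: sact_idem|move=> w; exact: psi_bal].
Qed.
End Bal.

(** The map c moves the idempotents along: conjugation by s for the left action, the identity for
    right multiplication and for module maps. *)
Lemma bals_tenmap (V V' : lmodType (monalg K S)) (h : {linear restrict V -> restrict V'})
    (k : {linear RK -> RK}) (c : E -> E) :
    (forall e v, h (sact (val e) v) = sact (val (c e)) (h v)) ->
    (forall e r, k (lmulr (unitd th (val e)) r) = lmulr (unitd th (val (c e))) (k r)) ->
  forall l x, tenmap h k (bals l x) = bals (map c l) (tenmap h k x).
Proof.
move=> hE kE l x; elim: l => //= e l <-.
by apply: tenmap_cut; [exact: hE|exact: kE].
Qed.

Lemma unbalanced_tenmap (V V' : lmodType (monalg K S))
    (h : {linear restrict V -> restrict V'}) (k : {linear RK -> RK}) (c : E -> E) :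
    (forall e v, h (sact (val e) v) = sact (val (c e)) (h v)) ->
    (forall e r, k (lmulr (unitd th (val e)) r) = lmulr (unitd th (val (c e))) (k r)) ->
  forall x, unbalanced x -> unbalanced (tenmap h k x).
Proof.
move=> hE kE x [l lx]; exists (map c l).
by rewrite -(bals_tenmap hE kE) lx linear0.
Qed.

(** s e = s (s^-1 s) e = s e (s^-1 s), because idempotents commute. *)
Lemma idem_conjE s (e : E) : (s * val e = val (idem_conj s e) * s)%g.
Proof.
rewrite /= -!mulgA -(idempotent_comm (idempotent_Vg s) (valP e)).
by rewrite !mulgA mulgVg.
Qed.

Lemma incl_unitd_conj a s (e : E) : incl th a * unitd th s * unitd th (val e)
  = unitd th (val (idem_conj s e)) * (incl th a * unitd th s).
Proof.
rewrite -mulrA unitdM idem_conjE -unitdM (unitd_idem _ (valP (idem_conj s e))).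
by rewrite !mulrA -!inclM -uone_central.
Qed.

Lemma sact_conj (V : lmodType (monalg K S)) s (e : E) (v : restrict V) :
  sact s (sact (val e) v) = sact (val (idem_conj s e)) (sact s v).
Proof. by rewrite -!sactM idem_conjE. Qed.

Lemma lmulr_conj a s (e : E) (x : RK) :
  lmulr (incl th a * unitd th s) (lmulr (unitd th (val e)) x)
  = lmulr (unitd th (val (idem_conj s e))) (lmulr (incl th a * unitd th s) x).
Proof. by rewrite /lmulr mulrA incl_unitd_conj -mulrA. Qed.

Section Bimodule.
Variable V : lmodType (monalg K S).
Local Notation T := (tensor (restrict V) RK).
Let Y := quoT (unbalanced_sub V).
Let bt (v : restrict V) (w : RK) : Y := cls _ (ten v w).

Let btDl v v' w : bt (v + v') w = bt v w + bt v' w.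
Proof. by rewrite /bt tenDl clsD. Qed.
Let btDr v w w' : bt v (w + w') = bt v w + bt v w'.
Proof. by rewrite /bt tenDr clsD. Qed.
Let bt_bal (e : E) v w : bt (sact (val e) v) w = bt v (lmulr (unitd th (val e)) w).
Proof. by apply/clsP; apply: unbalanced_gen. Qed.
Let bt_ext (U : zmodType) (f g : Y -> U) :
  {morph f : x y / x + y} -> {morph g : x y / x + y} ->
  (forall v w, f (bt v w) = g (bt v w)) -> f =1 g.
Proof.
move=> fD gD fg y; rewrite -[y]repK; move: (rep y).
by apply: tensor_ext => // x x'; rewrite clsD ?fD ?gD.
Qed.

Section Descend.
Variables (h : {linear restrict V -> restrict V}) (k : {linear RK -> RK}) (c : E -> E).
Hypotheses (hE : forall e v, h (sact (val e) v) = sact (val (c e)) (h v))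
  (kE : forall e r, k (lmulr (unitd th (val e)) r) = lmulr (unitd th (val (c e))) (k r)).
Let d (y : Y) : Y := cls _ (tenmap h k (rep y)).
Let d_cls x : d (cls _ x) = cls _ (tenmap h k x).
Proof.
apply/clsP; rewrite -linearB; apply: (unbalanced_tenmap hE kE).
exact: (rep_cls (unbalanced_sub V)).
Qed.
Lemma descend_linear : linear d.
Proof.
by move=> a x y; rewrite -[x]repK -[y]repK -linearP !d_cls !linearP.
Qed.
Lemma descend_bt v w : d (bt v w) = bt (h v) (k w).
Proof. by rewrite /bt d_cls tenmapE. Qed.
End Descend.

Let gen s a (y : Y) : Y := cls _ (tenmap (sact s) (lmulr (incl th a * unitd th s)) (rep y)).
Let rho r (y : Y) : Y := cls _ (tenmap idfun (rmulr r) (rep y)).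

Let gen_linear s a : linear (gen s a).
Proof.
apply: (@descend_linear _ _ (idem_conj s)) => [e v|e r].
  exact: sact_conj.
exact: lmulr_conj.
Qed.
Let gen_bt s a v w : gen s a (bt v w) = bt (sact s v) (lmulr (incl th a * unitd th s) w).
Proof.
apply: (@descend_bt _ _ (idem_conj s)) => [e {}v|e r].
  exact: sact_conj.
exact: lmulr_conj.
Qed.
Let genDr s a : {morph gen s a : x y / x + y}.
Proof. exact: (linearD (linmap (gen_linear s a))). Qed.
Let rho_linear r : linear (rho r).
Proof. by apply: (@descend_linear _ _ id) => // e x; rewrite /= /rmulr /lmulr mulrA. Qed.
Let rho_bt r v w : rho r (bt v w) = bt v (rmulr r w).
Proof. by apply: (@descend_bt _ _ id) => // e x; rewrite /= /rmulr /lmulr mulrA. Qed.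
Let rhoD r : {morph rho r : x y / x + y}.
Proof. exact: (linearD (linmap (rho_linear r))). Qed.

Let genDl s y : {morph gen s ^~ y : a b / a + b}.
Proof.
move=> a b; move: y; apply: bt_ext => [x y|x y|v w].
- exact: genDr.
- by rewrite !genDr addrACA.
by rewrite !gen_bt -btDr /lmulr inclD !mulrDl.
Qed.

Let incl_uone s a : incl th (1_s * a) * unitd th s = incl th a * unitd th s.
Proof.
rewrite !incl_unitdE; congr qcls; apply: lval_inj.
by rewrite !lval_delta mulrA uone_idem.
Qed.

Let gen_uone s a y : gen s (1_s * a) y = gen s a y.
Proof. by rewrite /gen incl_uone. Qed.

(** For s = e t both sides equal t v (x) u_e a u_t w. On the side of s this requires moving e from
    the left factor to the right one, so the balancing is what makes the order relators act as 0. *)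
Let gen_le s t a y : nle s t -> gen s (1_s * a) y = gen t (1_s * a) y.
Proof.
move=> [e ee ->]; move: y; apply: bt_ext => [||v w]; [exact: genDr|exact: genDr|].
have uoneM : 1_(e * t)%g = 1_e * 1_t.
  by rewrite -[1_(_ * _)%g]act1 -act_comp act1 act_idem.
pose f : E := exist _ e ee.
have aE : incl th (1_(e * t)%g * a) * unitd th t = unitd th e * (incl th a * unitd th t).
  by rewrite uoneM -mulrA inclM (unitd_idem _ ee) -mulrA incl_uone.
have -> : gen (e * t)%g (1_(e * t)%g * a) (bt v w)
    = gen (e * t)%g a (bt v w) by exact: gen_uone.
rewrite !gen_bt aE sactM -unitdM [incl th a * _]mulrA.
rewrite (unitd_idem _ ee) -inclM -uone_central inclM -(unitd_idem _ ee).
rewrite (bt_bal f) /lmulr /=.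
by rewrite !mulrA unitdM (eqP ee).
Qed.

Let genM s t a b y : gen s a (gen t b y) = gen (s * t)%g (a * act th s b) y.
Proof.
move: y; apply: bt_ext => [x y|x y|v w]; rewrite ?genDr //.
rewrite !gen_bt sactM; congr bt.
rewrite /lmulr -unitdM inclM !mulrA.
by rewrite -[X in X * unitd th t * w]mulrA unitd_incl_act !mulrA.
Qed.

Let gen1 y : gen 1%g 1 y = y.
Proof.
move: y; apply: bt_ext => [||v w]; [exact: genDr|by []|].
by rewrite gen_bt sact1 /lmulr unitd1 !mul1r.
Qed.

Let lam := left_act (th := th) gen.
Let lamDl y : {morph lam ^~ y : p q / p + q}.
Proof. exact: left_actDl. Qed.
Let lam_gen a s y : lam (incl th a * unitd th s) y = gen s a y.
Proof. exact: left_act_gen. Qed.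
Let lam1 y : lam 1 y = y.
Proof. exact: left_act1. Qed.
Let lamM p q y : lam (p * q) y = lam p (lam q y).
Proof. exact: left_actM. Qed.
Let lam0 y : lam 0 y = 0.
Proof. exact: (add_morph0 (lamDl y)). Qed.

Let lam_linear p : linear (lam p).
Proof.
move=> k x y; elim/crossed_ind: p => [|p q hp hq|a s].
- by rewrite !lam0 scaler0 addr0.
- by rewrite !lamDl hp hq scalerDr addrACA.
by rewrite !lam_gen gen_linear.
Qed.

Let btZr k v w : bt v (k *: w) = k *: bt v w.
Proof. by rewrite /bt tenZr linearZ. Qed.
Let scaleD k : {morph (fun y : Y => k *: y) : x y / x + y}.
Proof. exact: scalerDr. Qed.

Let lam_scal k p q y : lam (scal k * p + q) y = k *: lam p y + lam q y.
Proof.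
rewrite lamDl lamM; congr (_ + _).
have -> : scal k = incl th (scal k) * unitd th 1%g by rewrite unitd1 mulr1.
rewrite lam_gen; move: (lam p y); apply: bt_ext => [||v w].
- exact: genDr.
- exact: scaleD.
by rewrite gen_bt sact1 -btZr /lmulr unitd1 mulr1.
Qed.

Let rho_scal k a b y : rho (scal k * a + b) y = k *: rho a y + rho b y.
Proof.
move: y; apply: bt_ext => [x y|x y|v w].
- exact: rhoD.
- by rewrite !rhoD scalerDr addrACA.
rewrite !rho_bt -btZr -btDr /rmulr mulrDr; congr (bt v (_ + _)).
by rewrite mulrA -scalC -mulrA.
Qed.
Let rho1 y : rho 1 y = y.
Proof.
by move: y; apply: bt_ext => // v w; rewrite rho_bt /rmulr mulr1.
Qed.
Let rhoM a b y : rho (a * b) y = rho b (rho a y).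
Proof.
move: y; apply: bt_ext => [x y|x y|v w]; rewrite ?rhoD // !rho_bt.
by rewrite /rmulr mulrA.
Qed.
Let lam_rho a b y : lam a (rho b y) = rho b (lam a y).
Proof.
elim/crossed_ind: a => [|p q hp hq|a s].
- by rewrite !lam0 (add_morph0 (rhoD b)).
- by rewrite !lamDl hp hq rhoD.
rewrite !lam_gen; move: y; apply: bt_ext => [x y|x y|v w].
- by rewrite rhoD genDr.
- by rewrite genDr rhoD.
by rewrite !(rho_bt, gen_bt) /rmulr /lmulr mulrA.
Qed.

(** An opaque package, as for [tensor]: the surjection from V (x)_K R, its kernel and the action on
    generators are all that is used afterwards. *)
Lemma balanced_exists : {N : lmodType (env R) &
  {pr : {linear T -> restrict N} | [/\ forall y, exists x, pr x = y,
    forall x, pr x = 0 <-> unbalanced x &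
    forall a s b v r, tens (incl th a * unitd th s) b *: (pr (ten v r) : N)
      = pr (ten (sact s v) (incl th a * unitd th s * (r : R) * b : RK))]}}.
Proof.
pose N := bimod lam_linear rho_linear lam_scal rho_scal lam1 rho1 lamM rhoM lam_rho.
pose p (x : T) : restrict N := cls (unbalanced_sub V) x.
have pL : linear p.
  by move=> k x y; rewrite /p linearP restrictE bimod_scal.
exists N, (linmap pL); split=> [y|x|a s b v r].
- by exists (rep y); apply: (repK (y : Y)).
- rewrite linmapE /p -[X in _ = X <-> _](linear0 (cls (unbalanced_sub V))).
  by rewrite clsP subr0.
rewrite bimod_tens !linmapE -[p _]/(bt _ _) rho_bt lam_gen gen_bt.
by rewrite /lmulr /rmulr mulrA.
Qed.
End Bimodule.
End BalancedTensor.

Section MonoidAlgebraModules.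
Variables (K : comPzRingType) (S : monoidType).

Lemma monalg_linear (V W : lmodType (monalg K S)) (h : V -> W) :
  {morph h : x y / x + y} ->
  (forall k x, h ((scal k : monalg K S) *: x) = (scal k : monalg K S) *: h x) ->
  (forall s x, h (mdelta K s *: x) = mdelta K s *: h x) -> linear h.
Proof.
move=> hD hk hs a u v; rewrite hD; congr (_ + _).
elim/dsum_ind: a => [|f g hf hg|s k].
- by rewrite !scale0r add_morph0.
- by rewrite !scalerDl hD hf hg.
have -> : delta s k = (scal (k : K) : monalg K S) * mdelta K s.
  by rewrite [RHS]mmul_delta mul1g mulr1.
by rewrite -!scalerA hk hs.
Qed.
End MonoidAlgebraModules.

Lemma scale_morphD (E : pzRingType) (M N : lmodType E) (h : M -> N) (a b : E) x :
  {morph h : x y / x + y} -> h (a *: x) = a *: h x -> h (b *: x) = b *: h x ->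
  h ((a + b) *: x) = (a + b) *: h x.
Proof. by move=> hD ha hb; rewrite !scalerDl hD ha hb. Qed.

Section RestrictLinear.
Variables (K : comPzRingType) (R : pzAlgType K) (V W : lmodType R).
Variable f : {linear V -> W}.
Definition restrict_fun (x : restrict V) : restrict W := f (x : V).
Lemma restrict_fun_linear : linear restrict_fun.
Proof. by move=> k x y; rewrite !restrictE /restrict_fun linearP. Qed.
HB.instance Definition _ := GRing.isLinear.Build K (restrict V) (restrict W) *:%R
  restrict_fun restrict_fun_linear.
End RestrictLinear.

(** * Universal property and functoriality of the balanced tensor product *)

Section BalancedTensorFunctor.
Variables (K : comPzRingType) (S : inverseMonoidType) (A : pzAlgType K).
Variable th : unital_action S A.
Local Notation R := (crossed th).
Local Notation RK := (restrict (R^o : lmodType R)).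
Local Notation "1_ s" := (uone th s) (at level 8, s at level 2, format "1_ s").
Local Notation KS := (monalg K S).
Implicit Types V W : lmodType KS.

(* R (x)_{KE(S)} V, with [bt v r] for r (x) v. *)
Definition balten V : lmodType (env R) := projT1 (balanced_exists th V).
Definition bpr V : {linear tensor (restrict V) RK -> restrict (balten V)} :=
  projT1 (projT2 (balanced_exists th V)).
Definition bt V (v : V) (r : R) : balten V := bpr V (ten (v : restrict V) (r : RK)).

Lemma bpr_surj V y : exists x, bpr V x = y.
Proof.
exact: (let: And3 h _ _ := projT2 (projT2 (balanced_exists th V)) in h y).
Qed.
Lemma bpr_eq0 V x : bpr V x = 0 <-> unbalanced x.
Proof.
exact: (let: And3 _ h _ := projT2 (projT2 (balanced_exists th V)) in h x).
Qed.
Lemma tens_bt V a s b (v : V) r : tens (incl th a * unitd th s) b *: bt v r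
  = bt (mdelta K s *: v) (incl th a * unitd th s * r * b).
Proof.
exact: (let: And3 _ _ h := projT2 (projT2 (balanced_exists th V)) in h a s b v r).
Qed.

Lemma btDl V (v v' : V) r : bt (v + v') r = bt v r + bt v' r.
Proof. by rewrite /bt (tenDl (v : restrict V)) linearD. Qed.
Lemma btDr V (v : V) r r' : bt v (r + r') = bt v r + bt v r'.
Proof. by rewrite /bt (tenDr (v : restrict V) (r : RK)) linearD. Qed.
Lemma btZl V k (v : V) r : bt ((scal k : KS) *: v) r = (scal k : env R) *: bt v r.
Proof. by rewrite /bt (tenZl k (v : restrict V)) linearZ. Qed.
Lemma btZr V k (v : V) r : bt v (scal k * r) = (scal k : env R) *: bt v r.
Proof. by rewrite /bt (tenZr k (v : restrict V) (r : RK)) linearZ. Qed.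
Lemma bt_bal V e (v : V) r :
  idempotent e -> bt (mdelta K e *: v) r = bt v (unitd th e * r).
Proof.
move=> ee; apply/eqP; rewrite -subr_eq0 -linearB; apply/eqP/bpr_eq0.
exact: (unbalanced_gen (exist _ e ee : idemT S) (v : restrict V) (r : RK)).
Qed.
Lemma tens_bt1 V b (v : V) r : tens 1 b *: bt v r = bt v (r * b).
Proof.
by have := tens_bt 1 1%g b v r; rewrite unitd1 !mul1r scale1r.
Qed.

Lemma balten_ext V (U : zmodType) (f g : balten V -> U) :
  {morph f : x y / x + y} -> {morph g : x y / x + y} ->
  (forall v r, f (bt v r) = g (bt v r)) -> f =1 g.
Proof.
move=> fD gD fg y; have [x <-] := bpr_surj y; move: x.
by apply: tensor_ext => [x x'|x x'|v w]; rewrite ?linearD ?fD ?gD // fg.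
Qed.

Section Lift.
Variables (V : lmodType KS) (M : lmodType (env R)) (phi : V -> R -> M).
Hypotheses (phiDl : forall r, {morph phi ^~ r : v w / v + w})
  (phiDr : forall v, {morph phi v : r s / r + s})
  (phiZl : forall k v r, phi ((scal k : KS) *: v) r = (scal k : env R) *: phi v r)
  (phiZr : forall k v r, phi v (scal k * r) = (scal k : env R) *: phi v r)
  (phi_bal : forall e v r, idempotent e ->
     phi (mdelta K e *: v) r = phi v (unitd th e * r)).

Lemma lift_bilinear :
  bilinear (phi : restrict V -> RK -> restrict M).
Proof.
split=> [r|v] k x y; rewrite !restrictE ?phiDl ?phiDr ?phiZl //.
by rewrite -phiZr.
Qed.

(** Evaluated on a chosen preimage under [bpr]; by [balten_lift_pr] the choice does not matter,
    since phi is balanced. *)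
Definition balten_lift (y : balten V) : M :=
  tlift lift_bilinear (projT1 (cid (bpr_surj y))).

Lemma balten_lift_pr x : balten_lift (bpr V x) = tlift lift_bilinear x.
Proof.
rewrite /balten_lift; case: cid => x' /= x'E.
apply/eqP; rewrite -subr_eq0 -linearB; apply/eqP.
apply: (unbalanced_null (th := th)) => [y z|e v r|].
- by rewrite linearD.
- by rewrite !tliftE; apply: phi_bal (valP e).
by apply/bpr_eq0; rewrite linearB x'E subrr.
Qed.
Lemma balten_lift_bt v r : balten_lift (bt v r) = phi v r.
Proof. by rewrite balten_lift_pr tliftE. Qed.
Lemma balten_liftD : {morph balten_lift : x y / x + y}.
Proof.
move=> y y'; have [[x <-] [x' <-]] := (bpr_surj y, bpr_surj y').
by rewrite -linearD !balten_lift_pr linearD.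
Qed.

Lemma balten_lift_linear :
  (forall a s b v r, phi (mdelta K s *: v) (incl th a * unitd th s * r * b)
     = tens (incl th a * unitd th s) b *: phi v r) -> linear balten_lift.
Proof.
move=> phiS; apply: env_linear => [|p b y]; first exact: balten_liftD.
elim/crossed_ind: p => [|p q hp hq|a s].
- by rewrite tens0l !scale0r (add_morph0 balten_liftD).
- rewrite tensDl; exact (scale_morphD balten_liftD hp hq).
move: y; apply: balten_ext => [x y|x y|v r].
- by rewrite scalerDr balten_liftD.
- by rewrite balten_liftD scalerDr.
by rewrite tens_bt !balten_lift_bt phiS.
Qed.
End Lift.

Section Map.
Variables (V W : lmodType KS) (d : {linear V -> W}).

Definition balmap : balten V -> balten W :=
  balten_lift (phi := fun v r => bt (d v) r)
    (fun r x y => etrans (congr1 (fun w => bt w r) (linearD d x y)) (btDl _ _ _))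
    (fun v => btDr (d v))
    (fun k v r => etrans (congr1 (fun w => bt w r) (linearZ_LR d _ v)) (btZl k _ _))
    (fun k v r => btZr k (d v) r).
Lemma balmap_bt v r : balmap (bt v r) = bt (d v) r.
Proof.
by apply: balten_lift_bt => e {}v {}r ee; rewrite linearZ_LR bt_bal.
Qed.
Lemma balmap_linear : linear balmap.
Proof.
apply: balten_lift_linear => [e v r ee|a s b v r].
  by rewrite linearZ_LR bt_bal.
by rewrite linearZ_LR tens_bt.
Qed.
HB.instance Definition _ :=
  GRing.isLinear.Build (env R) (balten V) (balten W) *:%R balmap balmap_linear.
Lemma balmap_pr x :
  balmap (bpr V x) = bpr W (tenmap (restrict_fun d) (idfun : {linear RK -> RK}) x).
Proof.
move: x; apply: tensor_ext => [x y|x y|v r]; rewrite ?linearD //.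
by rewrite tenmapE; apply: balmap_bt.
Qed.
End Map.
End BalancedTensorFunctor.

(* The library lemmas, restated with the ring structure that is inferred from a
   K-algebra: unifying its two forms is very slow for enveloping algebras. *)
Section AlgebraModules.
Variables (K : comPzRingType) (E : pzAlgType K) (M N : lmodType E).
Lemma alg_scaleA (a b : E) (x : M) : a *: (b *: x) = (a * b) *: x.
Proof. exact: scalerA. Qed.
Lemma alg_scaleDl (a b : E) (x : M) : (a + b) *: x = a *: x + b *: x.
Proof. exact: scalerDl. Qed.
Lemma alg_scaleDr (a : E) (x y : M) : a *: (x + y) = a *: x + a *: y.
Proof. exact: scalerDr. Qed.
Lemma alg_scale1 (x : M) : (1 : E) *: x = x.
Proof. exact: scale1r. Qed.
Lemma alg_linZ (g : {linear M -> N}) (a : E) (x : M) : g (a *: x) = a *: g x.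
Proof. exact: linearZ_LR. Qed.

Section Product.
Variables (R : pzAlgType K) (t : R -> R -> E).
Hypothesis tM : forall a b c d, t a b * t c d = t (a * c) (d * b).

(** In bimodule notation, u x u r = x u u r = x u r. With u = u_e it shows that the transpose of a
    KS-linear map is balanced. *)
Lemma balanced_comp (u r : R) (x : M) :
  u * u = u -> t u 1 *: x = t 1 u *: x -> t 1 r *: (t u u *: x) = t 1 (u * r) *: x.
Proof.
move=> uu ux; rewrite scalerA tM mul1r.
have -> : t u (u * r) = t 1 (u * r) * t u 1 by rewrite tM !mul1r.
by rewrite -scalerA ux scalerA tM mul1r mulrA uu.
Qed.

(** In bimodule notation, u x (v a u) r b = u x a' r b = u a' x r b = a u x r b. With u = u_s and v
    = u_(s^-1) it makes the transpose a bimodule map. *)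
Lemma twisted_comp (u v a a' r b : R) (x : M) :
    v * (a * u) = a' -> u * a' = a * u -> t a' 1 *: x = t 1 a' *: x ->
  t 1 (a * u * r * b) *: (t u v *: x) = t (a * u) b *: (t 1 r *: x).
Proof.
move=> va ua a'x; rewrite !scalerA !tM mul1r mulr1 !mulrA -[v * a * u]mulrA va.
have -> : t u (a' * r * b) = t u (r * b) * t 1 a' by rewrite tM mulr1 mulrA.
by rewrite -scalerA -a'x scalerA tM mul1r ua.
Qed.

End Product.
End AlgebraModules.

(** * The adjunction with invariants *)
Section Invariants.
Variables (K : comPzRingType) (S : inverseMonoidType) (A : pzAlgType K).
Variable th : unital_action S A.
Local Notation R := (crossed th).
Local Notation "1_ s" := (uone th s) (at level 8, s at level 2, format "1_ s").
Local Notation KS := (monalg K S).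

Lemma tens_bt_incl (V : lmodType KS) a b (v : V) (r : R) :
  tens (incl th a) b *: bt v r = bt v (incl th a * r * b).
Proof.
by have := tens_bt a 1%g b v r; rewrite unitd1 mulr1 alg_scale1.
Qed.

Section Elements.
Variable M : lmodType (env R).

Definition inv_val (x : invariants M) : M :=
  val (x : subT (inv_sub (incl th) M)).
Lemma inv_valD : {morph inv_val : x y / x + y}. Proof. by []. Qed.
Lemma inv_val_inj : injective inv_val. Proof. exact: val_inj. Qed.
Lemma inv_valP x a : tens (incl th a) 1 *: inv_val x = tens 1 (incl th a) *: inv_val x.
Proof. exact: (subTP (x : subT (inv_sub (incl th) M))). Qed.
Definition inv_intro (m : M)
  (h : forall a, tens (incl th a) 1 *: m = tens 1 (incl th a) *: m) : invariants M :=
  subI (P := inv_sub (incl th) M) h.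
Lemma inv_introE m h : inv_val (@inv_intro m h) = m. Proof. by []. Qed.
Lemma inv_val_mdelta s x : inv_val (mdelta K s *: x)
  = tens (unitd th s) (unitd th s^-1%g) *: inv_val x.
Proof. by rewrite /inv_val [mdelta K s *: x]rep_mdelta. Qed.
Lemma inv_val_scal k x :
  inv_val ((scal k : KS) *: x) = (scal k : env R) *: inv_val x.
Proof. by rewrite /inv_val [_ *: x]rep_scal. Qed.
End Elements.

Section Map.
Variables (M N : lmodType (env R)) (g : {linear M -> N}).
Lemma inv_map_subproof (x : invariants M) a :
  tens (incl th a) 1 *: g (inv_val x) = tens 1 (incl th a) *: g (inv_val x).
Proof.
exact (etrans (esym (alg_linZ g _ _)) (etrans (congr1 g (inv_valP x a)) (alg_linZ g _ _))).
Qed.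
Definition inv_map (x : invariants M) : invariants N := inv_intro (inv_map_subproof x).
Lemma inv_map_linear : linear inv_map.
Proof.
apply: monalg_linear => [x y|k x|s x]; apply: inv_val_inj.
- by rewrite inv_valD !inv_introE inv_valD linearD.
- by rewrite inv_val_scal !inv_introE inv_val_scal alg_linZ.
- by rewrite inv_val_mdelta !inv_introE inv_val_mdelta alg_linZ.
Qed.
End Map.

Section Adjunction.
Variables (V : lmodType KS) (M : lmodType (env R)).

Section Left.
Variable c : {linear V -> invariants M}.
Let phi (v : V) (r : R) : M := tens 1 r *: inv_val (c v).

Let phiDl r : {morph phi ^~ r : v w / v + w}.
Proof. by move=> v w; rewrite /phi linearD inv_valD alg_scaleDr. Qed.
Let phiDr v : {morph phi v : r s / r + s}.
Proof. by move=> r s; rewrite /phi tensDr alg_scaleDl. Qed.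
Let phiZl k v r : phi ((scal k : KS) *: v) r = (scal k : env R) *: phi v r.
Proof. by rewrite /phi alg_linZ inv_val_scal !alg_scaleA scalC. Qed.
Let phiZr k v r : phi v (scal k * r) = (scal k : env R) *: phi v r.
Proof. by rewrite /phi tens_scalr alg_scaleA. Qed.
Let phi_bal e v r : idempotent e -> phi (mdelta K e *: v) r = phi v (unitd th e * r).
Proof.
move=> ee; have eV : (e^-1 = e)%g.
  by apply/esym/inv_uniq; rewrite !(eqP ee).
rewrite /phi alg_linZ inv_val_mdelta eV.
apply (balanced_comp (@tensM K R)); first by rewrite unitdM (eqP ee).
by rewrite (unitd_idem _ ee); exact (inv_valP _ _).
Qed.
Let phiS a s b v r : phi (mdelta K s *: v) (incl th a * unitd th s * r * b)
  = tens (incl th a * unitd th s) b *: phi v r.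
Proof.
(* Here u_(s^-1) u_s = 1_(s^-1), which is absorbed because it is the identity of the range of the
   action of s^-1. *)
have uaE : unitd th s^-1%g * (incl th a * unitd th s) = incl th (act th s^-1%g a).
  have := unitd_mulV th s^-1%g; rewrite invgK => uV.
  rewrite mulrA unitd_incl -mulrA uV -inclM.
  by rewrite -uone_central act_ran.
rewrite /phi alg_linZ inv_val_mdelta.
exact (twisted_comp (@tensM K R) _ _ uaE (esym (incl_unitd th a s)) (inv_valP _ _)).
Qed.

Definition adj_fun : balten th V -> M := balten_lift phiDl phiDr phiZl phiZr.
Lemma adj_linear : linear adj_fun.
Proof. exact (balten_lift_linear phiDl phiDr phiZl phiZr phi_bal phiS). Qed.
Lemma adj_bt v (r : R) : adj_fun (bt v r) = tens 1 r *: inv_val (c v).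
Proof. exact (balten_lift_bt phiDl phiDr phiZl phiZr phi_bal v r). Qed.
End Left.

Section Right.
Variable h : {linear balten th V -> M}.
Lemma coadj_subproof (v : V) a :
  tens (incl th a) 1 *: h (bt v (1 : R)) = tens 1 (incl th a) *: h (bt v (1 : R)).
Proof.
have inv_bt : tens (incl th a) 1 *: bt v (1 : R) = tens 1 (incl th a) *: bt v (1 : R).
  by rewrite [LHS]tens_bt_incl [RHS]tens_bt1 mul1r !mulr1.
exact (etrans (esym (alg_linZ h _ _)) (etrans (congr1 h inv_bt) (alg_linZ h _ _))).
Qed.
Definition coadj (v : V) : invariants M := inv_intro (coadj_subproof v).
Lemma coadj_linear : linear coadj.
Proof.
apply: monalg_linear => [x y|k x|s x]; apply: inv_val_inj.
- by rewrite inv_valD !inv_introE btDl linearD.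
- by rewrite inv_val_scal !inv_introE btZl alg_linZ.
rewrite inv_val_mdelta !inv_introE -alg_linZ; congr (h _).
(* u_s (v (x) 1) u_(s^-1) = s v (x) 1_s, and 1_s is the class u_e for e = s s^-1. It crosses to the
   left factor, where s s^-1 s = s absorbs it. *)
have := tens_bt (th := th) 1 s (unitd th s^-1%g) x 1.
rewrite mul1r mulr1 unitd_mulV => ->.
rewrite -[incl th _]mulr1 -uone_gV -(unitd_idem _ (idempotent_gV s)) -bt_bal ?idempotent_gV //.
by rewrite alg_scaleA [_ * mdelta K s]mmul_delta mulr1 mulgVg.
Qed.
End Right.
End Adjunction.
End Invariants.

Section HomLinear.
Variables (K : comPzRingType) (E : pzAlgType K) (P N : lmodType E).
Definition hom_lin (c : homT P N) : {linear P -> N} :=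
  linmap (subTP (P := linear_sub P N) c).
Lemma hom_ext (c c' : homT P N) : hom_lin c =1 hom_lin c' -> c = c'.
Proof. by move=> cc; apply: val_inj; apply/funext. Qed.
Definition hom_intro (f : P -> N) (fL : linear f) : homT P N :=
  subI (P := linear_sub P N) fL.
Lemma hom_linP k (c c' : homT P N) x :
  hom_lin (k *: c + c') x = (scal k : E) *: hom_lin c x + hom_lin c' x.
Proof. by []. Qed.
Lemma scaler_scalP k (a : E) (x y : N) :
  a *: ((scal k : E) *: x + y) = (scal k : E) *: (a *: x) + a *: y.
Proof. by rewrite scalerDr !scalerA scalC. Qed.
End HomLinear.

Lemma hom_lin_precomp (K : comPzRingType) (E : pzAlgType K) (P Q N : lmodType E)
    (d : {linear Q -> P}) (c : homT P N) x :
  hom_lin (precomp d c) x = hom_lin c (d x).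
Proof. by []. Qed.

(** * The adjunction on spaces of homomorphisms *)

Section HomAdjunction.
Variables (K : comPzRingType) (S : inverseMonoidType) (A : pzAlgType K).
Variable th : unital_action S A.
Local Notation R := (crossed th).
Local Notation KS := (monalg K S).

Section Fixed.
Variables (V : lmodType KS) (M : lmodType (env R)).

Definition adjh (c : homT V (invariants M)) : homT (balten th V) M :=
  hom_intro (adj_linear (hom_lin c)).
Definition coadjh (h : homT (balten th V) M) : homT V (invariants M) :=
  hom_intro (coadj_linear (hom_lin h)).

Lemma adjhE c v (r : R) : hom_lin (adjh c) (bt v r) = tens 1 r *: inv_val (hom_lin c v).
Proof. exact (adj_bt (hom_lin c) v r). Qed.
Lemma coadjhE h v : inv_val (hom_lin (coadjh h) v) = hom_lin h (bt v 1).
Proof. by []. Qed.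

Lemma balten_hom_ext (h h' : homT (balten th V) M) :
  (forall v (r : R), hom_lin h (bt v r) = hom_lin h' (bt v r)) -> h = h'.
Proof.
move=> hh; apply: hom_ext.
exact (balten_ext (linearD (hom_lin h)) (linearD (hom_lin h')) hh).
Qed.

Lemma adjh_linear : linear adjh.
Proof.
move=> k c c'; apply: balten_hom_ext => v r.
rewrite hom_linP !adjhE hom_linP inv_valD inv_val_scal.
exact (scaler_scalP k _ _ _).
Qed.
Lemma coadjh_linear : linear coadjh.
Proof.
move=> k h h'; apply: hom_ext => v; apply: inv_val_inj.
by rewrite coadjhE !hom_linP inv_valD inv_val_scal !coadjhE.
Qed.
HB.instance Definition _ := GRing.isLinear.Build K _ _ *:%R adjh adjh_linear.
HB.instance Definition _ := GRing.isLinear.Build K _ _ *:%R coadjh coadjh_linear.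

Lemma adjhK : cancel adjh coadjh.
Proof.
move=> c; apply: hom_ext => v; apply: inv_val_inj; rewrite coadjhE adjhE.
by rewrite tens1 [LHS]alg_scale1.
Qed.
Lemma coadjhK : cancel coadjh adjh.
Proof.
move=> h; apply: balten_hom_ext => v r; rewrite adjhE coadjhE.
rewrite -[LHS]alg_linZ; congr (hom_lin h _).
by rewrite tens_bt1 mul1r.
Qed.
End Fixed.

Lemma adjh_precomp (V W : lmodType KS) (M : lmodType (env R)) (d : {linear V -> W})
    (c : homT W (invariants M)) :
  precomp (balmap (th := th) d) (adjh c) = adjh (precomp d c).
Proof.
apply: balten_hom_ext => v r.
rewrite [RHS]adjhE [in RHS]hom_lin_precomp -[RHS]adjhE.
exact (congr1 (hom_lin (adjh c)) (balmap_bt d v r)).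
Qed.
End HomAdjunction.

(** * Restriction of bimodules along an algebra homomorphism *)

Section Pullback.
Variable K : comPzRingType.

Section RestrictBimodule.
Variables (B C : pzAlgType K) (j : B -> C).
Hypotheses (jD : {morph j : a b / a + b}) (jM : {morph j : a b / a * b})
  (j1 : j 1 = 1) (jscal : forall k, j (scal k) = scal k).
Variable M : lmodType (env C).

Let lam (b : B) (x : restrict M) : restrict M := tens (j b) 1 *: (x : M).
Let rho (b : B) (x : restrict M) : restrict M := tens 1 (j b) *: (x : M).
Let lam_linear b : linear (lam b).
Proof. by move=> k x y; rewrite !restrictE; exact (scaler_scalP k _ _ _). Qed.
Let rho_linear b : linear (rho b).
Proof. by move=> k x y; rewrite !restrictE; exact (scaler_scalP k _ _ _). Qed.
Let lam_scal k a a' y : lam (scal k * a + a') y = k *: lam a y + lam a' y.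
Proof.
rewrite restrictE /lam jD jM jscal tensPl.
by rewrite [LHS]alg_scaleDl -[in LHS]alg_scaleA.
Qed.
Let rho_scal k a a' y : rho (scal k * a + a') y = k *: rho a y + rho a' y.
Proof.
rewrite restrictE /rho jD jM jscal tensPr.
by rewrite [LHS]alg_scaleDl -[in LHS]alg_scaleA.
Qed.
Let lam1 y : lam 1 y = y.
Proof. by rewrite /lam j1 tens1 [LHS]alg_scale1. Qed.
Let rho1 y : rho 1 y = y.
Proof. by rewrite /rho j1 tens1 [LHS]alg_scale1. Qed.
Let lamM a b y : lam (a * b) y = lam a (lam b y).
Proof. by rewrite /lam [RHS]alg_scaleA tensM jM mulr1. Qed.
Let rhoM a b y : rho (a * b) y = rho b (rho a y).
Proof. by rewrite /rho [RHS]alg_scaleA tensM jM mulr1. Qed.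
Let lam_rho a b y : lam a (rho b y) = rho b (lam a y).
Proof. by rewrite /rho /lam [RHS]alg_scaleA [LHS]alg_scaleA !tensM !mulr1 !mul1r. Qed.

Definition pullback : lmodType (env B) :=
  bimod lam_linear rho_linear lam_scal rho_scal lam1 rho1 lamM rhoM lam_rho.
Lemma pullback_tens a b (x : pullback) : tens a b *: x = (tens (j a) (j b) *: (x : M) : M).
Proof. by rewrite [LHS]bimod_tens /lam /rho [LHS]alg_scaleA tensM !mulr1. Qed.
End RestrictBimodule.

Section PullbackMap.
Variables (B C : pzAlgType K) (j : B -> C).
Hypotheses (jD : {morph j : a b / a + b}) (jM : {morph j : a b / a * b})
  (j1 : j 1 = 1) (jscal : forall k, j (scal k) = scal k).
Variables (M N : lmodType (env C)) (g : {linear M -> N}).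
Let pb := pullback jD jM j1 jscal.

Definition pullback_map (x : pb M) : pb N := g (x : M).
Lemma pullback_map_linear : linear pullback_map.
Proof.
apply: env_linear => [x y|a b x]; first exact: (linearD g).
rewrite [RHS]pullback_tens /pullback_map [X in g X]pullback_tens.
exact (alg_linZ g _ _).
Qed.

(** An element w commuting with B defines the bimodule map b |-> b w; right linearity is where b w =
    w b enters. *)
Lemma central_linear (w : N) : (forall b, tens (j b) 1 *: w = tens 1 (j b) *: w) ->
  linear (fun b : reg B => (tens (j b) 1 *: w : pb N)).
Proof.
move=> wc; have wM a b x : tens (j (a * x * b)) 1 *: w
    = tens (j a) (j b) *: (tens (j x) 1 *: w).
  rewrite [RHS]alg_scaleA tensM !jM mul1r.
  have -> : tens (j a * j x) (j b) = tens (j a * j x) 1 * tens 1 (j b).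
    by rewrite tensM !mulr1.
  by rewrite -[RHS]alg_scaleA -wc [RHS]alg_scaleA tensM mulr1.
apply: env_linear => [a b|a b x].
  by rewrite jD tensDl; exact (alg_scaleDl _ _ w).
by rewrite [RHS]pullback_tens reg_tens; exact (wM a b x).
Qed.
End PullbackMap.

End Pullback.

(** * Consequences of separability *)

Section Separability.
Variables (K : comPzRingType) (S : inverseMonoidType) (A : pzAlgType K).
Variable th : unital_action S A.
Local Notation R := (crossed th).
Local Notation KS := (monalg K S).

(** The bimodule map a |-> a y from A to N lifts through g, since A is projective over its
    enveloping algebra; the value of the lift at 1 is an invariant above y. *)
Lemma invariants_surj (M N : lmodType (env R)) (g : {linear M -> N}) :
  separable A -> (forall y, exists x, g x = y) ->
  forall y : invariants N, exists x : invariants M, inv_map g x = y.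
Proof.
move=> Asep gsurj y.
have yc := inv_valP y.
have [|h hE] := Asep _ _
  (linmap (@pullback_map_linear _ _ _ _ (inclD th) (inclM th) (incl1 th) (incl_scal th) M N g))
  (linmap (central_linear (inclD th) (inclM th) (incl1 th) (incl_scal th) yc)).
  by move=> v; have [u gu] := gsurj v; exists u.
pose m : M := h (1 : A).
have hM a b : h (a * b : A) = tens (incl th a) (incl th b) *: m.
  have := alg_linZ h (tens a b) (1 : A).
  by rewrite [X in h X]reg_tens mulr1 [X in _ = X]pullback_tens.
have mc a : tens (incl th a) 1 *: m = tens 1 (incl th a) *: m.
  have := hM 1 a; have := hM a 1; rewrite mulr1 mul1r => ha1 h1a.
  exact (etrans (esym ha1) h1a).
exists (inv_intro mc); apply: inv_val_inj.
rewrite inv_introE inv_introE.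
have := hE (1 : A); rewrite !linmapE => e; rewrite incl1 tens1 in e.
exact (etrans e (alg_scale1 (inv_val y))).
Qed.

(** A left adjoint of a functor preserving surjections preserves projectives: transpose f, lift it
    over the invariants and transpose back. *)
Lemma balten_projective (P : lmodType KS) :
  separable A -> projective P -> projective (balten th P).
Proof.
move=> Asep Pproj U W g f gsurj.
have [h hE] := Pproj _ _ (linmap (inv_map_linear g)) (linmap (coadj_linear f))
  (invariants_surj Asep gsurj).
exists (linmap (adj_linear h)).
apply: balten_ext => [x y|x y|v r].
- by rewrite (linearD (linmap (adj_linear h))) (linearD g).
- exact: (linearD f).
have hv : g (inv_val (h v)) = f (bt v (1 : R)) := congr1 (@inv_val _ _ _ _ _) (hE v).
rewrite linmapE adj_bt [LHS]alg_linZ hv -[LHS]alg_linZ.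
by rewrite tens_bt1 mul1r.
Qed.
End Separability.

(** * The resolution of the crossed product *)
Section Exactness.
Variables (K : fieldType) (S : inverseMonoidType) (A : pzAlgType K).
Variable th : unital_action S A.
Local Notation R := (crossed th).
Local Notation RK := (restrict (R^o : lmodType R)).
Local Notation KS := (monalg K S).
Variables U V W : lmodType KS.
Variables (f : {linear U -> V}) (g : {linear V -> W}).

(** If the image of x under g vanishes in N(W), finitely many projections kill it over K. They
    commute with g, so applied to x they give a kernel element over K, which exactness over K lifts;
    being idempotent, they do not change the class of x in N(V). *)
Lemma balmap_exact : (forall v, g v = 0 <-> exists u, f u = v) ->
  forall y : balten th V, balmap g y = 0 <-> exists x, balmap f x = y.
Proof.
move=> fg y; split=> [|[x <-]]; last first.
  have gf u : g (f u) = 0 by apply/fg; exists u.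
  have : (fun x => balmap g (balmap (th := th) f x)) =1 (fun=> 0).
    apply: balten_ext => [x1 x2|x1 x2|v r].
    - by rewrite !linearD.
    - by rewrite addr0.
    - by rewrite !balmap_bt gf (add_morph0 (fun v v' => btDl v v' r)).
  by apply.
have [x <-] := bpr_surj y; rewrite balmap_pr => /bpr_eq0[l lx].
have lg : tenmap (restrict_fun g) (idfun : {linear RK -> RK}) (bals l x) = 0.
  rewrite (bals_tenmap (c := id)) ?map_id // => e v.
  exact (alg_linZ g (mdelta K (val e)) v).
have [z zE] := tensor_exact (f := restrict_fun f) (g := restrict_fun g) (fun v => (fg v).1) lg.
exists (bpr th U z); rewrite balmap_pr zE; apply/eqP; rewrite -subr_eq0 -linearB.
apply/eqP/bpr_eq0; exists l; rewrite linearB /= bals_idem subrr //.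
Qed.
End Exactness.

(** * The identification of N(KE(S)) with the crossed product *)

Section Augmentation.
Variables (K : comPzRingType) (S : inverseMonoidType) (A : pzAlgType K).
Variable th : unital_action S A.
Local Notation R := (crossed th).
Local Notation KS := (monalg K S).
Local Notation E := (idemT S).

Definition ke_unitd (x : KE K S) : R :=
  dlift (fun (e : E) (k : K^o) => scal (k : K) * unitd th (val e)) x.

Lemma ke_unitdD : {morph ke_unitd : x y / x + y}.
Proof. by apply: dliftD => e k l; rewrite scalD mulrDl. Qed.
Lemma ke_unitd_delta e k : ke_unitd (delta e k) = scal (k : K) * unitd th (val e).
Proof. by rewrite /ke_unitd dlift_delta // => f a b; rewrite scalD mulrDl. Qed.
Lemma ke_unitd0 : ke_unitd 0 = 0.
Proof. exact: (add_morph0 ke_unitdD). Qed.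

Lemma KE_mdelta s e k : mdelta K s *: (delta e k : KE K S) = delta (idem_conj s e) k.
Proof. by rewrite [LHS]rep_mdelta [LHS]ke_act_delta. Qed.
Lemma KE_scal l e (k : K^o) :
  (scal l : KS) *: (delta e k : KE K S) = delta e (l * k : K^o).
Proof. by rewrite [LHS]rep_scal -deltaZ. Qed.

Lemma KE_ind (Q : KE K S -> Prop) :
  Q 0 -> (forall x y, Q x -> Q y -> Q (x + y)) ->
  (forall (e : E) (k : K^o), Q (delta e k)) -> forall x, Q x.
Proof. exact: dsum_ind. Qed.

Lemma ke_unitd_scal l x : ke_unitd ((scal l : KS) *: x) = scal l * ke_unitd x.
Proof.
elim/KE_ind: x => [|x y hx hy|e k].
- by rewrite scaler0 ke_unitd0 mulr0.
- by rewrite alg_scaleDr !ke_unitdD mulrDr; exact (congr2 +%R hx hy).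
by rewrite KE_scal !ke_unitd_delta scalM mulrA.
Qed.

(** The linear extension of u_(s e s^-1) a u_s = a u_s u_e, which is the left linearity of the
    augmentation. *)
Lemma ke_unitd_conj a s x : ke_unitd (mdelta K s *: x) * (incl th a * unitd th s)
  = incl th a * unitd th s * ke_unitd x.
Proof.
elim/KE_ind: x => [|x y hx hy|e k].
- by rewrite scaler0 ke_unitd0 mulr0 mul0r.
- by rewrite alg_scaleDr !ke_unitdD mulrDl mulrDr; exact (congr2 +%R hx hy).
rewrite KE_mdelta !ke_unitd_delta -mulrA -incl_unitd_conj.
by rewrite [RHS]mulrA -[in RHS]scalC !mulrA.
Qed.

Lemma ke_unitd_idem e x : idempotent e ->
  ke_unitd (mdelta K e *: x) = ke_unitd x * unitd th e.
Proof.
move=> ee; have eV : (e^-1 = e)%g by apply/esym/inv_uniq; rewrite !(eqP ee).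
elim/KE_ind: x => [|x y hx hy|f k].
- by rewrite scaler0 ke_unitd0 mul0r.
- by rewrite alg_scaleDr !ke_unitdD mulrDl hx hy.
rewrite KE_mdelta !ke_unitd_delta -mulrA unitdM /= eV.
by rewrite (idempotent_comm ee (valP f)) -mulgA (eqP ee).
Qed.

Let phi (x : KE K S) (r : R) : reg R := ke_unitd x * r.
Let phiDl r : {morph phi ^~ r : v w / v + w}.
Proof. by move=> x y; rewrite /phi ke_unitdD mulrDl. Qed.
Let phiDr x : {morph phi x : r s / r + s}.
Proof. by move=> r s; rewrite /phi mulrDr. Qed.
Let reg_scal k (x : reg R) : (scal k : env R) *: x = (scal k * (x : R) : R).
Proof. by rewrite scal_tens [LHS]reg_tens mulr1. Qed.
Let phiZl k x r : phi ((scal k : KS) *: x) r = (scal k : env R) *: phi x r.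
Proof. by rewrite reg_scal /phi ke_unitd_scal mulrA. Qed.
Let phiZr k x r : phi x (scal k * r) = (scal k : env R) *: phi x r.
Proof. by rewrite reg_scal /phi mulrA -scalC -mulrA. Qed.
Let phi_bal e x r : idempotent e -> phi (mdelta K e *: x) r = phi x (unitd th e * r).
Proof. by move=> ee; rewrite /phi ke_unitd_idem // mulrA. Qed.
Let phiS a s b x r : phi (mdelta K s *: x) (incl th a * unitd th s * r * b)
  = tens (incl th a * unitd th s) b *: phi x r.
Proof. by rewrite [RHS]reg_tens /phi !mulrA -ke_unitd_conj !mulrA. Qed.

Definition ke_aug : {linear balten th (KE K S) -> reg R} :=
  linmap (balten_lift_linear phiDl phiDr phiZl phiZr phi_bal phiS).
Lemma ke_aug_bt x r : ke_aug (bt x r) = (ke_unitd x * r : R).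
Proof. exact (balten_lift_bt phiDl phiDr phiZl phiZr phi_bal x r). Qed.

Definition ke_one : KE K S :=
  delta (exist _ 1%g (introT eqP (mulg1 1%g)) : E) (1 : K^o).

Lemma ke_unitd_one : ke_unitd ke_one = 1.
Proof. by rewrite ke_unitd_delta scal1 mul1r. Qed.

(** Since e = e 1 in KE(S), the idempotent crosses the tensor sign, and every element takes the
    normal form 1 (x) r. *)
Lemma bt_ke_one x (r : R) : bt x r = bt ke_one (ke_unitd x * r).
Proof.
elim/KE_ind: x => [|x y hx hy|e k].
- rewrite ke_unitd0 mul0r (add_morph0 (btDr ke_one)).
  exact: (add_morph0 (fun v v' => btDl v v' r)).
- by rewrite ke_unitdD mulrDl btDr btDl hx hy.
(* S acts on KE(S) by conjugation, and e 1 e^-1 = e for an idempotent e. *)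
have -> : delta e k = (scal (k : K) : KS) *: (mdelta K (val e) *: ke_one).
  rewrite KE_mdelta KE_scal mulr1; congr delta; apply: val_inj => /=.
  have eV : ((val e)^-1 = val e)%g by apply/esym/inv_uniq; rewrite !(eqP (valP e)).
  by rewrite mulg1 [X in (_ * X)%g]eV (eqP (valP e)).
rewrite ke_unitd_scal (ke_unitd_idem _ (valP e)) ke_unitd_one mul1r.
by rewrite btZl (bt_bal _ _ (valP e)) -mulrA btZr.
Qed.

Lemma ke_aug_inj y : ke_aug y = 0 -> y = 0.
Proof.
have yE : y = bt ke_one (ke_aug y : R).
  move: y; apply: balten_ext => [x y //|x y|x r]; first by rewrite linearD btDr.
  by rewrite ke_aug_bt -bt_ke_one.
by move=> y0; rewrite yE y0 (add_morph0 (btDr ke_one)).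
Qed.
End Augmentation.

(** * The transported resolution and its cochain complex *)

Section Resolution.
Variables (K : fieldType) (S : inverseMonoidType) (A : pzAlgType K).
Variable th : unital_action S A.
Hypothesis Asep : separable A.
Variable P : resolution (KE K S).
Local Notation R := (crossed th).

Let aug : {linear balten th (rmod P 0) -> reg R} :=
  (ke_aug th \o balmap (th := th) (raug P)).
Let diff n : {linear balten th (rmod P n.+1) -> balten th (rmod P n)} :=
  balmap (th := th) (rdiff P n).

Let augE y : aug y = ke_aug th (balmap (raug P) y). Proof. by []. Qed.

Lemma balten_aug_surj x : exists y, aug y = x.
Proof.
(* For any lift p of the idempotent 1, the element p (x) x maps to 1 x = x. *)
have [p pE] := raug_surj P (ke_one K S).
by exists (bt p (x : R)); rewrite augE balmap_bt pE ke_aug_bt ke_unitd_one mul1r.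
Qed.
Lemma balten_aug_exact y : aug y = 0 <-> exists z, diff 0 z = y.
Proof.
rewrite -(balmap_exact (@raug_exact _ _ P)) augE.
by split=> [/ke_aug_inj //|->]; rewrite linear0.
Qed.
Lemma balten_diff_exact n y : diff n y = 0 <-> exists z, diff n.+1 z = y.
Proof. exact: balmap_exact (@rdiff_exact _ _ P n) y. Qed.

Definition balten_resolution : resolution (reg R) :=
  Resolution (fun n => balten_projective (th := th) Asep (@rmod_projective _ _ P n))
    balten_aug_surj balten_aug_exact balten_diff_exact.

(** The adjunction is natural, so it is an isomorphism of cochain complexes: both round trips are
    identities and the connecting boundaries are 0. *)
Lemma Ext_balten (M : lmodType (env R)) n :
  exists F : {linear Ext_of P (invariants M) n -> Ext_of balten_resolution M n},
    bijective F.
Proof.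
have coadjh_precomp (V W : lmodType (monalg K S)) (d : {linear V -> W}) (c : homT (balten th W) M) :
    coadjh (precomp (balmap (th := th) d) c) = precomp d (coadjh c).
  by rewrite -{1}[c]coadjhK adjh_precomp adjhK.
case: n => [|n]; apply: (@cohomology_iso _ _ _ _ _ _ _ _ _ _ _
    (@adjh _ _ _ th (rmod P _) M) (@coadjh _ _ _ th (rmod P _) M)).
- by move=> v v0; rewrite [LHS]adjh_precomp v0 linear0.
- by move=> v v0; rewrite -[LHS]coadjh_precomp v0 linear0.
- by move=> u; exists 0; rewrite !linear0.
- by move=> u; exists 0; rewrite !linear0.
- by move=> v _; exists 0; rewrite /= adjhK subrr.
- by move=> v _; exists 0; rewrite /= coadjhK subrr.
- by move=> v v0; rewrite [LHS]adjh_precomp v0 linear0.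
- by move=> v v0; rewrite -[LHS]coadjh_precomp v0 linear0.
- by move=> u; exists (adjh u); rewrite [RHS]adjh_precomp.
- by move=> u; exists (coadjh u); rewrite -[RHS]coadjh_precomp.
- by move=> v _; exists 0; rewrite linear0 /= adjhK subrr.
- by move=> v _; exists 0; rewrite linear0 /= coadjhK subrr.
Qed.
End Resolution.

Theorem corollary5p12 (K : fieldType) (S : inverseMonoidType)
    (A : pzAlgType K) (theta : unital_action S A) (hA : separable A)
    (M : lmodType (env (crossed theta))) (n : nat) :
  exists f : {linear inverse_cohomology (invariants M) n ->
                     hochschild M n}%type,
    bijective f.
Proof.
have [F Fbij] := Ext_balten hA (free_resolution (KE K S)) M n.
have [G Gbij] := Ext_resolution M (balten_resolution theta hA (free_resolution (KE K S)))
  (free_resolution (reg (crossed theta))) n.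
exists (G \o F); exact: bij_comp.
Qed.
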